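(* Let $\pi\in S_n$ be inverse-Grassmannian. There is a bijection $f:\mathrm{BPD}(\pi)\to\mathrm{PD}^{red}(\pi)$ such that $\mathrm{wt}(f(D))=\mathrm{wt}(D)$ for all $D$ and $f$ is an isomorphism of posets from $\mathrm{droop}(\pi)$ to $\mathrm{slide}(\pi)$, i.e. $D\le E$ in $\mathrm{droop}(\pi)$ iff $f(D)\le f(E)$ in $\mathrm{slide}(\pi)$.
   Context: $\pi$ is Grassmannian if it has at most one descent (index $i$ with $\pi(i)>\pi(i+1)$); inverse-Grassmannian if $\pi^{-1}$ is Grassmannian. Pipe dreams: tilings of the $n\times n$ grid (rows top to bottom, columns left to right) by cross tiles and elbow tiles (arcs joining north–west and south–east edges), with all positions $(i,j)$, $i+j\ge n+1$, elbows; pipes $1..n$ enter at the north border (pipe $j$ above column $j$) and exit at the west border; reduced if no two pipes cross twice, with permutation $\pi(i)$ = label of pipe exiting row $i$. $\mathrm{PD}^{red}(\pi)$ = reduced pipe dreams with permutation $\pi$; weight $\prod x_r$ over crosses $(r,c)$. The bottom pipe dream is the unique element of $\mathrm{PD}^{red}(\pi)$ whose crosses in each row are left-justified. A simple slide: if a pipe dream has a cross at $(r,c)$ and elbows at $(r,c+1),(r-1,c),(r-1,c+1)$, move the cross to $(r-1,c+1)$. $\mathrm{slide}(\pi)$ is the set of pipe dreams reachable from the bottom pipe dream by sequences of simple slides, ordered by the reflexive–transitive closure of $D<D'$ when $D'$ is obtained from $D$ by a simple slide. Bumpless pipe dreams (BPD): tilings of the $n\times n$ grid by cross, horizontal, vertical,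 r-tile (elbow joining south and east edges), j-tile (elbow joining north and west edges), and blank tiles forming $n$ pipes from the south border to the east border; reduced if no two pipes cross twice; pipes labelled $1..n$ left to right on the south border, permutation $\pi(i)$ = label of pipe exiting row $i$. $\mathrm{BPD}(\pi)$ = reduced BPDs with permutation $\pi$; weight $\prod x_i$ over blank tiles $(i,j)$. The Rothe BPD of $\pi$ is the BPD whose r-tiles are at positions $(i,\pi(i))$ and which has no j-tiles. A simple droop: if $(i,j)$ is an r-tile and $(i+1,j+1)$ is blank, then $(i+1,j)$ is a vertical tile or j-tile and $(i,j+1)$ is a horizontal tile or j-tile; replace $(i,j)$ by blank, $(i+1,j+1)$ by a j-tile, $(i+1,j)$ by an r-tile (if it was vertical) or a horizontal tile (if it was a j-tile), and $(i,j+1)$ by an r-tile (if it was horizontal) or a vertical tile (if it was a j-tile). $\mathrm{droop}(\pi)$ is the set of BPDs reachable from the Rothe BPD by sequences of simple droops, ordered by the reflexive–transitive closure of $D<D'$ when $D'$ is obtained from $D$ by a simple droop. (For such $\pi$ it is known that the underlying sets of $\mathrm{droop}(\pi)$ and $\mathrm{slide}(\pi)$ are $\mathrm{BPD}(\pi)$ and $\mathrm{PD}^{red}(\pi)$.) *)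

(* Defs.v *)
From HB Require Import structures.
From mathcomp Require Import all_boot all_order all_fingroup all_algebra.
From mathcomp Require Import mpoly.

Set Implicit Arguments.
Unset Strict Implicit.
Unset Printing Implicit Defensive.

Import GRing.Theory.

(* Rows, columns and pipes are numbered from 0: the row, column, pipe or
   variable k of the usual 1-based convention is the ordinal of value k - 1. *)

Section Grassmannian.
Variable n : nat.

Definition descents (s : 'S_n) : {set 'I_n} :=
  [set i : 'I_n | [exists j : 'I_n, (j == i.+1 :> nat) && (s j < s i)]].

Definition grassmannian (s : 'S_n) : bool := #|descents s| <= 1.

Definition inverse_grassmannian (s : 'S_n) : bool := grassmannian s^-1%g.

End Grassmannian.

Inductive side := North | South | West | East.

Definition side_code (s : side) : bool * bool :=
  match s with
  | North => (true, true)   | South => (true, false)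
  | West  => (false, true)  | East  => (false, false)
  end.
Definition side_decode (c : bool * bool) : side :=
  match c with
  | (true, true)  => North  | (true, false)  => South
  | (false, true) => West   | (false, false) => East
  end.
Lemma side_codeK : cancel side_code side_decode. Proof. by case. Qed.
HB.instance Definition _ := Finite.copy side (can_type side_codeK).

(* One type serves for both kinds of tilings. [Elbow] is the two-arc elbow
   tile of pipe dreams; [RTile], [JTile] are the one-arc elbows of bumpless
   pipe dreams. *)
Inductive tile := Cross | Elbow | Horizontal | Vertical | RTile | JTile | Blank.

Definition tile_code (t : tile) : bool * bool * bool :=
  match t with
  | Cross      => (true, true, true)    | Elbow    => (true, true, false)
  | Horizontal => (true, false, true)   | Vertical => (true, false, false)
  | RTile      => (false, true, true)   | JTile    => (false, true, false)
  | Blank      => (false, false, true)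
  end.
Definition tile_decode (c : bool * bool * bool) : tile :=
  match c with
  | (true, true, true)   => Cross       | (true, true, false)  => Elbow
  | (true, false, true)  => Horizontal  | (true, false, false) => Vertical
  | (false, true, true)  => RTile       | (false, true, false) => JTile
  | (false, false, _)    => Blank
  end.
Lemma tile_codeK : cancel tile_code tile_decode. Proof. by case. Qed.
HB.instance Definition _ := Finite.copy tile (can_type tile_codeK).

Definition arcs (t : tile) : seq (side * side) :=
  match t with
  | Cross      => [:: (North, South); (West, East)]
  | Elbow      => [:: (North, West); (South, East)]
  | Horizontal => [:: (West, East)]
  | Vertical   => [:: (North, South)]
  | RTile      => [:: (South, East)]
  | JTile      => [:: (North, West)]
  | Blank      => [::]
  end.

Definition joins (t : tile) (s s' : side) : bool :=
  ((s, s') \in arcs t) || ((s', s) \in arcs t).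

Definition touches (t : tile) (s : side) : bool := [exists s', joins t s s'].

Section Tilings.
Variable n : nat.
Implicit Types (D : 'M[tile]_n) (i j p q : 'I_n).

(* The unit segments of the grid: [inl (k, j)] is the horizontal segment at
   height k (0 = north border, n = south border) in column j, and [inr (i, k)]
   is the vertical segment at abscissa k (0 = west border, n = east border)
   in row i. *)
Definition segment : finType := (('I_n.+1 * 'I_n) + ('I_n * 'I_n.+1))%type.

Definition side_of i j (s : side) : segment :=
  match s with
  | North => inl (widen_ord (leqnSn n) i, j)
  | South => inl (lift ord0 i, j)
  | West  => inr (i, widen_ord (leqnSn n) j)
  | East  => inr (i, lift ord0 j)
  end.

Definition linked D : rel segment := fun e e' =>
  [exists i, [exists j, [exists s, [exists s',
    [&& joins (D i j) s s', e == side_of i j s & e' == side_of i j s']]]]].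

Section Pipes.
(* [start p] is the border segment at which pipe p enters, [exit i] the one at
   which a pipe leaves in row i. *)
Variables (start exit : 'I_n -> segment).

Definition on_pipe D p (e : segment) : bool := connect (linked D) (start p) e.

Definition crossings D p q : {set 'I_n * 'I_n} :=
  [set x | (D x.1 x.2 == Cross) &&
     (on_pipe D p (side_of x.1 x.2 North) && on_pipe D q (side_of x.1 x.2 West)
   || on_pipe D q (side_of x.1 x.2 North) && on_pipe D p (side_of x.1 x.2 West))].

Definition reduced D : bool :=
  [forall p, [forall q, (p != q) ==> (#|crossings D p q| <= 1)]].

Definition has_perm D (s : 'S_n) : bool :=
  [forall i, on_pipe D (s i) (exit i)].

End Pipes.

(* Pipe dreams: pipes run from the north border to the west border. *)

Definition pd_start p : segment := inl (ord0, p).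
Definition pd_exit i : segment := inr (i, ord0).

(* In 1-based coordinates the second condition is i + j >= n + 1. *)
Definition pd_tiling D : bool :=
  [forall i, [forall j, ((D i j == Cross) || (D i j == Elbow)) &&
                        ((n <= i + j + 1) ==> (D i j == Elbow))]].

Definition PDred (s : 'S_n) : {set 'M[tile]_n} :=
  [set D | [&& pd_tiling D, reduced pd_start D & has_perm pd_start pd_exit D s]].

Definition pd_wt D : {mpoly int[n]} :=
  (\prod_(x : 'I_n * 'I_n | D x.1 x.2 == Cross) 'X_(x.1))%R.

Definition bottom (s : 'S_n) D : bool :=
  (D \in PDred s) &&
  [forall i, [forall j : 'I_n, [forall k : 'I_n,
    (k < j) && (D i j == Cross) ==> (D i k == Cross)]]].

Definition slide_at D i i' j j' : 'M[tile]_n :=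
  (\matrix_(a, b) if (a, b) == (i', j) then Elbow
                  else if (a, b) == (i, j') then Cross
                  else D a b)%R.

Definition simple_slide : rel 'M[tile]_n := fun D D' =>
  [exists i : 'I_n, [exists i' : 'I_n, [exists j : 'I_n, [exists j' : 'I_n,
    [&& i' == i.+1 :> nat, j' == j.+1 :> nat,
        D i' j == Cross, D i' j' == Elbow, D i j == Elbow, D i j' == Elbow &
        D' == slide_at D i i' j j']]]]].

Definition slide (s : 'S_n) : {set 'M[tile]_n} :=
  [set D | [exists B, bottom s B && connect simple_slide B D]].

Definition slide_le (s : 'S_n) D E : bool :=
  [&& D \in slide s, E \in slide s & connect simple_slide D E].

(* Bumpless pipe dreams: pipes run from the south border to the east border. *)

Definition bpd_start p : segment := inl (ord_max, p).
Definition bpd_exit i : segment := inr (i, ord_max).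

(* Neighbouring tiles agree on their common side; the pipes occupy the whole
   south and east borders and no segment of the north and west borders. *)
Definition bpd_tiling D : bool :=
  [&& [forall i, [forall j, D i j != Elbow]],
      [forall i : 'I_n, [forall i' : 'I_n, [forall j, (i' == i.+1 :> nat) ==>
        (touches (D i j) South == touches (D i' j) North)]]],
      [forall i, [forall j : 'I_n, [forall j' : 'I_n, (j' == j.+1 :> nat) ==>
        (touches (D i j) East == touches (D i j') West)]]] &
      [forall i : 'I_n, [forall j : 'I_n,
        [&& (i == 0 :> nat) ==> ~~ touches (D i j) North,
            (j == 0 :> nat) ==> ~~ touches (D i j) West,
            (i.+1 == n) ==> touches (D i j) South &
            (j.+1 == n) ==> touches (D i j) East]]]].

Definition BPD (s : 'S_n) : {set 'M[tile]_n} :=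
  [set D | [&& bpd_tiling D, reduced bpd_start D &
               has_perm bpd_start bpd_exit D s]].

Definition bpd_wt D : {mpoly int[n]} :=
  (\prod_(x : 'I_n * 'I_n | D x.1 x.2 == Blank) 'X_(x.1))%R.

Definition rothe (s : 'S_n) D : bool :=
  [&& bpd_tiling D,
      [forall i, [forall j, (D i j == RTile) == (j == s i)]] &
      [forall i, [forall j, D i j != JTile]]].

(* In [droop_at], the tiles at (i', j) and (i, j') of a bumpless pipe dream with
   an r-tile at (i, j) and a blank at (i', j') are necessarily of one of the
   first two kinds in the corresponding match. *)
Definition droop_at D i i' j j' : 'M[tile]_n :=
  (\matrix_(a, b)
     if (a, b) == (i, j) then Blank
     else if (a, b) == (i', j') then JTile
     else if (a, b) == (i', j) then
       match D i' j with Vertical => RTile | JTile => Horizontal | t => t end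
     else if (a, b) == (i, j') then
       match D i j' with Horizontal => RTile | JTile => Vertical | t => t end
     else D a b)%R.

Definition simple_droop : rel 'M[tile]_n := fun D D' =>
  [exists i : 'I_n, [exists i' : 'I_n, [exists j : 'I_n, [exists j' : 'I_n,
    [&& i' == i.+1 :> nat, j' == j.+1 :> nat,
        D i j == RTile, D i' j' == Blank &
        D' == droop_at D i i' j j']]]]].

Definition droop (s : 'S_n) : {set 'M[tile]_n} :=
  [set D | [exists R, rothe s R && connect simple_droop R D]].

Definition droop_le (s : 'S_n) D E : bool :=
  [&& D \in droop s, E \in droop s & connect simple_droop D E].

End Tilings.

(* Main.v *)
(* The values of an inverse-Grassmannian permutation fall into two ranges,
   those below k and the others, each increasing in position, so a reduced
   tiling may only cross a pipe of one range with one of the other.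
   For a bumpless pipe dream this fixes all columns from k on and forbids
   crosses to their left; a reduced pipe dream becomes a five-vertex
   configuration of strands "< k" and "not < k" in the first k columns, in
   which every cross has its vertical strand below k and its horizontal one
   not. The mirror image of these k columns sends a blank tile to a cross and
   every other tile to an elbow: the horizontal edges used by the bumpless pipe
   dream and the vertical edges it avoids become the edges of the strands
   below k. Simple droops become simple slides, and having no j-tile becomes
   being left-justified.

   Pipes are followed by reading both kinds of tilings in the same order, each
   cell acting on a frontier of edges as an adjacent transposition or as the
   identity. *)
Require Import Defs.
From HB Require Import structures.
From mathcomp Require Import all_boot all_order all_fingroup all_algebra.
From mathcomp Require Import mpoly zify.

Set Implicit Arguments.
Unset Strict Implicit.
Unset Printing Implicit Defensive.

(** * Labels of edges *)

Definition straight (t : tile) : bool :=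
  match t with Cross | Horizontal | Vertical => true | _ => false end.

Definition touch (t : tile) (s : side) : bool :=
  match t, s with
  | Cross, _ | Elbow, _ => true
  | Horizontal, (West | East) | Vertical, (North | South)
  | RTile, (South | East) | JTile, (North | West) => true
  | _, _ => false
  end.

Lemma touchesE t s : touches t s = touch t s.
Proof.
apply/existsP/idP => [[s']|]; first by case: t; case: s; case: s'.
by case: t; case: s => // _; first [by exists North | by exists South
  | by exists West | by exists East].
Qed.

Lemma joinsC t s s' : joins t s s' = joins t s' s.
Proof. by rewrite /joins orbC. Qed.

Lemma ord_of_nat n x : x < n -> exists i : 'I_n, i = x :> nat.
Proof. by move=> lt_x; exists (Ordinal lt_x). Qed.

Section Grid.
Variable n : nat.

(** Induction in reading order: the north and east borders are known, and each cell passes knowledge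
    from its north and east sides to its west and south sides. *)
Lemma grid_ind (P : 'I_n -> 'I_n -> side -> Prop) :
    (forall i j : 'I_n, i = 0 :> nat -> P i j North) ->
    (forall i j : 'I_n, j.+1 = n -> P i j East) ->
    (forall i i' j : 'I_n, i' = i.+1 :> nat -> P i j South -> P i' j North) ->
    (forall i j j' : 'I_n, j' = j.+1 :> nat -> P i j' West -> P i j East) ->
    (forall i j : 'I_n, P i j North -> P i j East -> P i j West /\ P i j South) ->
  forall i j s, P i j s.
Proof.
move=> PN PE PNS PEW Pstep i j.
suff H m : forall i j : 'I_n, i * n + (n - j) < m -> P i j North /\ P i j East.
  have [hN hE] := H _ i j (ltnSn _).
  by have [hW hS] := Pstep _ _ hN hE; case.
elim: m => // m IH {}i {}j le_m.
have lti := ltn_ord i; have ltj := ltn_ord j.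
split.
  case: (posnP i) => [|i_gt0]; first exact: PN.
  have lti' : i.-1 < n by lia.
  apply: (PNS (Ordinal lti')) => /=; first lia.
  have [|hN hE] := IH (Ordinal lti') j; last by have [] := Pstep _ _ hN hE.
  rewrite /=; nia.
case: (ltnP j.+1 n) => [ltj'|]; last by move=> ?; apply: PE; lia.
apply: (PEW i j (Ordinal ltj')) => //.
have [|hN hE] := IH i (Ordinal ltj'); last by have [] := Pstep _ _ hN hE.
rewrite /=; nia.
Qed.

Definition swap_at (k x : nat) : nat :=
  if x == k then k.+1 else if x == k.+1 then k else x.

Lemma swap_atK k : involutive (swap_at k).
Proof. by move=> x; rewrite /swap_at; do ![case: ifP]; lia. Qed.

Variable D : 'M[tile]_n.

(* The cells are read row by row from the top, each row from right to left:
   the cell (r, c) comes at time r * n + (n - 1 - c). Just before that time the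
   edges of the frontier are numbered so that the north and east sides of
   (r, c) have numbers r + c and r + c + 1; just after, these are the numbers
   of its west and south sides. *)
Definition cell_pos (t : nat) : nat := t %/ n + (n.-1 - t %% n).

(** Cells outside the grid count as not straight, so that times from [n * n] on act as the
    identity. *)
Definition straight_cell (r c : nat) : bool :=
  match insub r : option 'I_n, insub c : option 'I_n with
  | Some i, Some j => straight (D i j)
  | _, _ => false
  end.

Definition straight_time (t : nat) : bool :=
  straight_cell (t %/ n) (n.-1 - t %% n).

Definition swap_time (t x : nat) : nat :=
  if straight_time t then swap_at (cell_pos t) x else x.

Lemma swap_timeK t : involutive (swap_time t).
Proof.
by move=> x; rewrite /swap_time; case: (straight_time t) => //; apply: swap_atK.
Qed.

(** A label is a number on the frontier at time 0; [pos t a] is the number that label [a] has at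
    time [t], and [lab t] is the inverse map. *)
Fixpoint pos (t a : nat) : nat :=
  if t is t'.+1 then swap_time t' (pos t' a) else a.

Fixpoint lab (t x : nat) : nat :=
  if t is t'.+1 then lab t' (swap_time t' x) else x.

Lemma posK t : cancel (pos t) (lab t).
Proof. by elim: t => //= t IH a; rewrite swap_timeK IH. Qed.

Lemma labK t : cancel (lab t) (pos t).
Proof. by elim: t => //= t IH x; rewrite IH swap_timeK. Qed.

Lemma lab_stable t1 t2 x : t1 <= t2 ->
    (forall t, t1 <= t < t2 -> x != cell_pos t /\ x != (cell_pos t).+1) ->
  lab t2 x = lab t1 x.
Proof.
move=> le_t; elim: t2 le_t => [|t2 IH] le_t ne_x; first by have -> : t1 = 0 by lia.
move: le_t; rewrite leq_eqVlt => /orP[/eqP <- //|lt_t] /=.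
have [|/negPf ne1 /negPf ne2] := ne_x t2; first lia.
have -> : swap_time t2 x = x by rewrite /swap_time /swap_at ne1 ne2 if_same.
by apply: IH => [|t ht]; [lia|apply: ne_x; lia].
Qed.

Lemma cell_pos_row r m : m < n -> cell_pos (r * n + m) = r + (n.-1 - m).
Proof.
move=> lt_m; rewrite /cell_pos divnMDl ?modnMDl; last lia.
by rewrite divn_small // modn_small // addn0.
Qed.

Lemma time_split t : 0 < n -> exists r m, t = r * n + m /\ m < n.
Proof. by move=> n_gt0; exists (t %/ n), (t %% n); rewrite -divn_eq ltn_pmod. Qed.

Definition time (i j : nat) : nat := i * n + (n.-1 - j).

Lemma time_of_ordK (i j : 'I_n) : cell_pos (time i j) = i + j.
Proof. have := ltn_ord j; move=> ?; rewrite cell_pos_row; lia. Qed.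

Lemma straight_time_ord (i j : 'I_n) : straight_time (time i j) = straight (D i j).
Proof.
have ltj := ltn_ord j.
have ltm : n.-1 - j < n by lia.
rewrite /straight_time /time divnMDl ?modnMDl; last lia.
rewrite divn_small // modn_small // addn0 /straight_cell.
have -> : n.-1 - (n.-1 - j) = j by lia.
by rewrite !valK.
Qed.

Lemma straight_time_cell t : straight_time t ->
  exists i j : 'I_n, t = time i j /\ straight (D i j).
Proof.
rewrite /straight_time /straight_cell.
case: insubP => // i _ def_i; case: insubP => // j lt_j def_j ij.
exists i, j; split => //; rewrite /time def_i def_j.
have lt_m : t %% n < n by rewrite ltn_pmod //; have := ltn_ord i; lia.
have -> : n.-1 - (n.-1 - t %% n) = t %% n by lia.
by rewrite -divn_eq.
Qed.

(* In a pipe dream, pipe p has label p; in a bumpless pipe dream, the pipe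
   leaving in row i has label n + i, and the labels below n belong to edges that
   no pipe uses. *)
Definition seg_lab (e : segment n) : nat :=
  match e with
  | inl (h, j) => lab (h * n + (n.-1 - j)) (h + j)
  | inr (i, a) => lab (i * n + (n - a)) (i + a)
  end.

Lemma seg_lab_north i j : seg_lab (side_of i j North) = lab (time i j) (i + j).
Proof. by []. Qed.

Lemma seg_lab_east i j : seg_lab (side_of i j East) = lab (time i j) (i + j).+1.
Proof.
have ltj := ltn_ord j.
have -> : time i j = i * n + (n - j.+1) by rewrite /time; lia.
by rewrite -addnS.
Qed.

Lemma seg_lab_west i j : seg_lab (side_of i j West) = lab (time i j).+1 (i + j).
Proof.
have ltj := ltn_ord j.
have -> : (time i j).+1 = i * n + (n - j) by rewrite /time; lia.
by [].
Qed.

Lemma seg_lab_south i j : seg_lab (side_of i j South) = lab (time i j).+1 (i + j).+1.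
Proof.
have ltj := ltn_ord j.
have -> : seg_lab (side_of i j South) = lab (i.+1 * n + (n.-1 - j)) (i + j).+1.
  by [].
(* Between this cell and the one below it, the cells read are those to the left in row [i], acting
   on numbers at most [i + j], and those to the right in the next row, acting on numbers at least
   [i + j + 2]. *)
rewrite /time; apply: lab_stable => [|t]; first nia.
have [r [m [-> lt_m]]] : exists r m, t = r * n + m /\ m < n.
  by apply: time_split; lia.
rewrite cell_pos_row // => ht.
have [?|[?|?]] : r = i \/ r = i.+1 \/ (r < i \/ i.+1 < r) by lia.
- subst r; nia.
- subst r; nia.
- nia.
Qed.

Lemma seg_lab_straight i j : straight (D i j) ->
  seg_lab (side_of i j West) = seg_lab (side_of i j East) /\
  seg_lab (side_of i j South) = seg_lab (side_of i j North).
Proof.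
rewrite seg_lab_west seg_lab_east seg_lab_south seg_lab_north => sij /=.
rewrite /swap_time straight_time_ord sij time_of_ordK /swap_at eqxx.
by rewrite eqxx; have -> : (i + j).+1 == i + j = false by lia.
Qed.

Lemma seg_lab_turn i j : ~~ straight (D i j) ->
  seg_lab (side_of i j West) = seg_lab (side_of i j North) /\
  seg_lab (side_of i j South) = seg_lab (side_of i j East).
Proof.
rewrite seg_lab_west seg_lab_east seg_lab_south seg_lab_north => sij /=.
by rewrite /swap_time straight_time_ord (negPf sij).
Qed.

Lemma seg_lab_NE i j : seg_lab (side_of i j North) != seg_lab (side_of i j East).
Proof.
rewrite seg_lab_north seg_lab_east.
apply/eqP => /(can_inj (labK _)); lia.
Qed.

Lemma side_of_SN (i i' j : 'I_n) : i' = i.+1 :> nat ->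
  side_of i j South = side_of i' j North.
Proof. by move=> def_i'; congr (inl (_, _)); apply: val_inj; rewrite /= def_i'. Qed.

Lemma side_of_EW (i j j' : 'I_n) : j' = j.+1 :> nat ->
  side_of i j East = side_of i j' West.
Proof. by move=> def_j'; congr (inr (_, _)); apply: val_inj; rewrite /= def_j'. Qed.

Lemma seg_lab_top (i j : 'I_n) : i = 0 :> nat -> seg_lab (side_of i j North) = j.
Proof.
have ltj := ltn_ord j.
move=> i0; rewrite seg_lab_north i0 add0n /time mul0n add0n.
rewrite (@lab_stable 0) // => t ht.
have -> : t = 0 * n + t by lia.
rewrite cell_pos_row; lia.
Qed.

Lemma seg_lab_right (i j : 'I_n) : j.+1 = n -> seg_lab (side_of i j East) = n + i.
Proof.
have ltj := ltn_ord j.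
move=> jn; rewrite seg_lab_east.
have -> : (i + j).+1 = n + i by lia.
rewrite (@lab_stable 0) // => t.
have [r [m [-> lt_m]]] : exists r m, t = r * n + m /\ m < n.
  by apply: time_split; lia.
rewrite cell_pos_row // /time => ht.
have : r < i by nia.
lia.
Qed.

Lemma seg_lab_joins i j s s' : joins (D i j) s s' ->
  seg_lab (side_of i j s) = seg_lab (side_of i j s').
Proof.
have := @seg_lab_straight i j; have := @seg_lab_turn i j.
by case: (D i j) => T S;
   first [have [hW hS] := S isT | have [hW hS] := T isT];
   case: s; case: s' => // _.
Qed.

Lemma linkedC e e' : linked D e e' = linked D e' e.
Proof.
suff H f f' : linked D f f' -> linked D f' f by apply/idP/idP; apply: H.
case/existsP=> i /existsP[j /existsP[s /existsP[s' /and3P[ss' es es']]]].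
apply/existsP; exists i; apply/existsP; exists j.
apply/existsP; exists s'; apply/existsP; exists s.
by rewrite joinsC ss' es es'.
Qed.

Lemma connect_linkedC : connect_sym (linked D).
Proof. exact: sym_connect_sym linkedC. Qed.

Lemma linked_side i j s s' : joins (D i j) s s' ->
  connect (linked D) (side_of i j s) (side_of i j s').
Proof.
move=> ss'; apply: connect1; apply/existsP; exists i; apply/existsP; exists j.
by apply/existsP; exists s; apply/existsP; exists s'; rewrite ss' !eqxx.
Qed.

Lemma seg_lab_connect e e' : connect (linked D) e e' -> seg_lab e = seg_lab e'.
Proof.
case/connectP=> p; elim: p e => [|e1 p IH] e /=; first by move=> _ ->.
case/andP=> /existsP[i /existsP[j /existsP[s /existsP[s' /and3P[ss' /eqP-> /eqP->]]]]].
by move=> hp he'; rewrite (seg_lab_joins ss'); apply: IH.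
Qed.

(** A colouring of the edges that propagates through cells as labels do depends only on the label,
    and is read off on the north and east borders. This is how geometric descriptions of sets of
    edges become statements about labels. *)
Lemma seg_lab_col (T : Type) (col : 'I_n -> 'I_n -> side -> T) (B : nat -> T) :
    (forall i i' j : 'I_n, i' = i.+1 :> nat -> col i j South = col i' j North) ->
    (forall i j j' : 'I_n, j' = j.+1 :> nat -> col i j East = col i j' West) ->
    (forall i j, straight (D i j) ->
       col i j West = col i j East /\ col i j South = col i j North) ->
    (forall i j, ~~ straight (D i j) ->
       col i j West = col i j North /\ col i j South = col i j East) ->
    (forall i j : 'I_n, i = 0 :> nat -> col i j North = B j) ->
    (forall i j : 'I_n, j.+1 = n -> col i j East = B (n + i)) ->
  forall i j s, col i j s = B (seg_lab (side_of i j s)).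
Proof.
move=> cSN cEW cs ct cN cE; apply: grid_ind.
- by move=> i j i0; rewrite cN ?seg_lab_top.
- by move=> i j jn; rewrite cE ?seg_lab_right.
- by move=> i i' j h; rewrite -(cSN i i' j h) -(side_of_SN _ h).
- by move=> i j j' h; rewrite (cEW i j j' h) (side_of_EW _ h).
move=> i j hN hE; case: (boolP (straight (D i j))) => sij.
  by have [-> ->] := cs _ _ sij; have [-> ->] := seg_lab_straight sij.
by have [-> ->] := ct _ _ sij; have [-> ->] := seg_lab_turn sij.
Qed.

(** * Exchanges of two labels and their relative order *)

Definition swapped (a b t : nat) : bool :=
  [&& straight_time t, pos t a == cell_pos t & pos t b == (cell_pos t).+1].

(** An adjacent transposition reverses the order of two labels only when it exchanges these two;
    [swapped a b t] says that it does so with [a] on the vertical strand and [b] on the horizontal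
    one. *)
Lemma pos_lt_keep a b t1 t2 : t1 <= t2 ->
    (forall t, t1 <= t < t2 -> ~~ swapped a b t) ->
  pos t1 a < pos t1 b -> pos t2 a < pos t2 b.
Proof.
move=> le_t; elim: t2 le_t => [|t2 IH] le_t nsw lt1; first by have <- : t1 = 0 by lia.
move: le_t; rewrite leq_eqVlt => /orP[/eqP <- //|lt_t].
have : ~~ swapped a b t2 by apply: nsw; lia.
have : pos t2 a < pos t2 b by apply: IH => // t ?; apply: nsw; lia.
rewrite /swapped /= /swap_time /swap_at.
case: (straight_time t2) => //=; do ![case: ifP]; lia.
Qed.

Lemma swapped_pos a b t : swapped a b t ->
  pos t.+1 a = (cell_pos t).+1 /\ pos t.+1 b = cell_pos t.
Proof.
case/and3P=> st /eqP pa /eqP pb /=; rewrite /swap_time st pa pb /swap_at.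
by split; do ![case: ifP]; lia.
Qed.

Lemma pos_inj t : injective (pos t).
Proof. exact: can_inj (posK t). Qed.

Lemma pos_keep_iff a b t1 t2 : t1 <= t2 ->
    (forall t, t1 <= t < t2 -> ~~ swapped a b t) ->
    (forall t, t1 <= t < t2 -> ~~ swapped b a t) ->
  (pos t1 a < pos t1 b) = (pos t2 a < pos t2 b).
Proof.
move=> le_t nab nba; apply/idP/idP; first exact: pos_lt_keep.
case: (ltngtP (pos t1 a) (pos t1 b)) => [//|lt_ba|/pos_inj ->]; last lia.
by have := pos_lt_keep le_t nba lt_ba; lia.
Qed.

Lemma swapped_ord a b (i j : 'I_n) :
  swapped a b (time i j) =
    [&& straight (D i j), a == seg_lab (side_of i j North)
      & b == seg_lab (side_of i j East)].
Proof.
rewrite /swapped straight_time_ord time_of_ordK seg_lab_north seg_lab_east.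
by rewrite -!(inj_eq (can_inj (posK (time i j))) a) !labK
           -!(inj_eq (can_inj (posK (time i j))) b) !labK.
Qed.

Lemma time_bound (i j : 'I_n) : time i j < n * n.
Proof. by have := ltn_ord i; have := ltn_ord j; rewrite /time; nia. Qed.

Lemma time_inj (i j i' j' : 'I_n) : time i j = time i' j' -> i = i' /\ j = j'.
Proof.
have [lti ltj lti' ltj'] := And4 (ltn_ord i) (ltn_ord j) (ltn_ord i') (ltn_ord j').
rewrite /time => e.
have ei : i = i' :> nat by nia.
by split; apply: val_inj => //=; nia.
Qed.

(** After the first exchange [b] stays before [a], whereas a second one would need [a] before
    [b]. *)
Lemma swapped_once a b t1 t2 : (forall t, ~~ swapped b a t) ->
  swapped a b t1 -> swapped a b t2 -> t1 = t2.
Proof.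
move=> nba; wlog lt_t : t1 t2 / t1 < t2 => [wl s1 s2|].
  by case: (ltngtP t1 t2) => // lt_t; [apply: wl | symmetry; apply: wl].
move=> /swapped_pos[pa pb] /and3P[_ /eqP pa2 /eqP pb2].
have : pos t2 b < pos t2 a by apply: (@pos_lt_keep b a t1.+1) => //; lia.
lia.
Qed.

Lemma swapped_inversion a b t T : t < T ->
    (forall t', ~~ swapped b a t') -> swapped a b t ->
  a < b /\ pos T b < pos T a.
Proof.
move=> lt_t nba sab; have [pa pb] := swapped_pos sab; split; last first.
  by apply: (@pos_lt_keep b a t.+1) => //; lia.
case: (ltngtP a b) => // [lt_ba|eq_ab].
  have : pos t b < pos t a by apply: (@pos_lt_keep b a 0).
  by case/and3P: sab => _ /eqP-> /eqP->; lia.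
by move: pa pb; rewrite eq_ab; lia.
Qed.

Lemma seg_lab_left (i j : 'I_n) : j = 0 :> nat ->
  seg_lab (side_of i j West) = lab (n * n) i.
Proof.
move=> j0; have ltj := ltn_ord j; have lti := ltn_ord i.
rewrite seg_lab_west j0 addn0 /time; symmetry; apply: lab_stable; first nia.
move=> t; have [r [m [-> lt_m]]] : exists r m, t = r * n + m /\ m < n.
  by apply: time_split; lia.
rewrite cell_pos_row // => ht.
have : i < r by nia.
lia.
Qed.

Lemma seg_lab_bottom (i j : 'I_n) : i.+1 = n ->
  seg_lab (side_of i j South) = lab (n * n) (n + j).
Proof.
move=> i_n; have ltj := ltn_ord j; have lti := ltn_ord i.
rewrite seg_lab_south /time.
have -> : (i + j).+1 = n + j by lia.
symmetry; apply: lab_stable; first nia.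
move=> t; have [r [m [-> lt_m]]] : exists r m, t = r * n + m /\ m < n.
  by apply: time_split; lia.
rewrite cell_pos_row // => ht.
have : r = i by nia.
move=> ?; subst r; nia.
Qed.

Lemma pos_bound a t : a < n + n -> t <= n * n -> pos t a < n + n.
Proof.
move=> lt_a; elim: t => //= t IH lt_t.
have : pos t a < n + n by apply: IH; lia.
have [r [m [et lt_m]]] : exists r m, t = r * n + m /\ m < n.
  by apply: time_split; lia.
have : cell_pos t = r + (n.-1 - m) by rewrite et cell_pos_row.
have : r < n by nia.
rewrite /swap_time /swap_at; case: (straight_time t) => //; do ![case: ifP]; lia.
Qed.

End Grid.

(** * Reducedness and order of labels *)

Section Pipes.
Variables (n : nat) (D : 'M[tile]_n).

Lemma pd_start_side (i p : 'I_n) : i = 0 :> nat -> pd_start p = side_of i p North.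
Proof. by move=> i0; congr (inl (_, _)); apply: val_inj; rewrite /= i0. Qed.

Lemma pd_exit_side (i j : 'I_n) : j = 0 :> nat -> pd_exit i = side_of i j West.
Proof. by move=> j0; congr (inr (_, _)); apply: val_inj; rewrite /= j0. Qed.

Lemma bpd_start_side (i p : 'I_n) : i.+1 = n -> bpd_start p = side_of i p South.
Proof. by move=> i_n; congr (inl (_, _)); apply: val_inj; rewrite /= -[LHS]i_n. Qed.

Lemma bpd_exit_side (i j : 'I_n) : j.+1 = n -> bpd_exit i = side_of i j East.
Proof. by move=> j_n; congr (inr (_, _)); apply: val_inj; rewrite /= -[LHS]j_n. Qed.

(** Labels are constant along pipes. This is the converse at an edge: it is connected to the very
    north or east border edge that its label names. *)
Definition entered (e : segment n) : Prop :=
  (exists2 p : 'I_n, seg_lab D e = p & connect (linked D) (pd_start p) e) \/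
  (exists2 i : 'I_n, seg_lab D e = n + i & connect (linked D) (bpd_exit i) e).

Lemma entered_joins i j s s' : joins (D i j) s s' ->
  entered (side_of i j s) -> entered (side_of i j s').
Proof.
move=> ss'; have lk := linked_side ss'.
by case=> -[x labx conx]; [left | right]; exists x;
  rewrite -?(seg_lab_joins ss') //; apply: connect_trans lk.
Qed.

Lemma touched_entered :
    (forall i i' j : 'I_n, i' = i.+1 :> nat ->
       touch (D i' j) North -> touch (D i j) South) ->
    (forall i j j' : 'I_n, j' = j.+1 :> nat ->
       touch (D i j) East -> touch (D i j') West) ->
  forall i j s, touch (D i j) s -> entered (side_of i j s).
Proof.
move=> tNS tEW; apply: grid_ind => [i j i0 _|i j jn _|i i' j h IH tN|i j j' h IH tE|].
- by left; exists j; [apply: seg_lab_top | rewrite (pd_start_side _ i0) connect0].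
- by right; exists i; [apply: seg_lab_right | rewrite (bpd_exit_side _ jn) connect0].
- by rewrite -(side_of_SN _ h); apply: IH (tNS _ _ _ h tN).
- by rewrite (side_of_EW _ h); apply: IH (tEW _ _ _ h tE).
move=> i j; have := @entered_joins i j; case: (D i j) => ent eN eE; split=> // _.
- exact: (ent East West isT (eE isT)).
- exact: (ent North South isT (eN isT)).
- exact: (ent North West isT (eN isT)).
- exact: (ent East South isT (eE isT)).
- exact: (ent East West isT (eE isT)).
- exact: (ent North South isT (eN isT)).
- exact: (ent East South isT (eE isT)).
- exact: (ent North West isT (eN isT)).
Qed.

Section Reduced.
Variables (start : 'I_n -> segment n) (lp : 'I_n -> nat).
Hypothesis lp_inj : injective lp.

(** Undoing the exchange made at a cross would require a second cross of the same two pipes. In a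
    reduced tiling the exchange is therefore final, and the two labels form an inversion. *)
Lemma cross_inversion :
    reduced start D ->
    (forall i j s p, seg_lab D (side_of i j s) = lp p ->
       on_pipe start D p (side_of i j s)) ->
    (forall i j p q, straight (D i j) -> seg_lab D (side_of i j North) = lp p ->
       seg_lab D (side_of i j East) = lp q -> D i j = Cross) ->
  forall i j p q, D i j = Cross -> seg_lab D (side_of i j North) = lp p ->
    seg_lab D (side_of i j East) = lp q ->
  lp p < lp q /\ pos D (n * n) (lp q) < pos D (n * n) (lp p).
Proof.
move=> redD onp crossD i j p q Dij labN labE.
have sw_cross p' q' (i' j' : 'I_n) : swapped D (lp p') (lp q') (time n i' j') ->
    D i' j' == Cross /\ on_pipe start D p' (side_of i' j' North)
                     /\ on_pipe start D q' (side_of i' j' West).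
  rewrite swapped_ord => /and3P[st /eqP lN /eqP lE].
  have [lW _] := seg_lab_straight st.
  by rewrite (@crossD i' j' p' q') //; do !split=> //; apply: onp; rewrite ?lW.
have swij : swapped D (lp p) (lp q) (time n i j).
  by rewrite swapped_ord Dij labN labE !eqxx.
have ne_pq : p != q.
  apply/eqP => eq_pq; have := seg_lab_NE D i j.
  by rewrite labN labE eq_pq eqxx.
apply: (swapped_inversion (time_bound i j)) => // t; apply/negP => swt.
have [i' [j' [def_t _]]] : exists i' j' : 'I_n, t = time n i' j' /\ straight (D i' j').
  by apply: straight_time_cell; case/and3P: swt.
move: swt; rewrite def_t => swt.
have [c1 [N1 W1]] := sw_cross _ _ _ _ swij.
have [c2 [N2 W2]] := sw_cross _ _ _ _ swt.
have /forallP/(_ p)/forallP/(_ q)/implyP/(_ ne_pq)/card_le1_eqP le1 := redD.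
have := le1 (i, j) (i', j'); rewrite !inE /= c1 c2 N1 W1 N2 W2 orbT.
move=> /(_ isT isT)[ei ej]; move: swt; rewrite ei ej swapped_ord labN.
by case/and3P=> _ /eqP/lp_inj eq_pq; rewrite eq_pq eqxx in ne_pq.
Qed.

(** If every exchange has its vertical strand in the class [c] and its horizontal one outside, no
    exchange can be undone, so two pipes cross at most once. *)
Lemma reduced_of_swaps (c : pred 'I_n) :
    (forall p e, on_pipe start D p e -> seg_lab D e = lp p) ->
    (forall t p q, swapped D (lp p) (lp q) t -> c p && ~~ c q) ->
  reduced start D.
Proof.
move=> labp swc; apply/forallP => p; apply/forallP => q; apply/implyP => ne_pq.
apply/card_le1_eqP.
suff H x p' q' : D x.1 x.2 = Cross -> on_pipe start D p' (side_of x.1 x.2 North) ->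
    on_pipe start D q' (side_of x.1 x.2 West) ->
    swapped D (lp p') (lp q') (time n x.1 x.2).
  have nsw p' q' t : swapped D (lp p') (lp q') t ->
      forall t', ~~ swapped D (lp q') (lp p') t'.
    move=> /swc/andP[cp cq] t'; apply/negP => /swc/andP[cq' _].
    by rewrite cq' in cq.
  have once p' q' (x y : 'I_n * 'I_n) : swapped D (lp p') (lp q') (time n x.1 x.2) ->
      swapped D (lp p') (lp q') (time n y.1 y.2) -> x = y.
    move=> swx swy; have [e1 e2] := time_inj (swapped_once (nsw _ _ _ swx) swx swy).
    by rewrite [x]surjective_pairing e1 e2 -surjective_pairing.
  move=> x y; rewrite !inE => /andP[/eqP cx px] /andP[/eqP cy py].
  case/orP: px => /andP[N1 W1]; case/orP: py => /andP[N2 W2];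
    have sx := H _ _ _ cx N1 W1; have sy := H _ _ _ cy N2 W2;
    first [by apply: once sy sx | by have := nsw _ _ _ sx (time n y.1 y.2); rewrite sy].
move=> cx /labp N1 /labp W1; rewrite swapped_ord cx N1.
have [<- _] : _ /\ _ := @seg_lab_straight n D x.1 x.2 (etrans (congr1 _ cx) erefl).
by rewrite W1 !eqxx.
Qed.

End Reduced.

(** On each class both maps are increasing enumerations of the same set of values; at a least
    argument [x] of disagreement, [f x < g x] and [g x < f x] would both follow. *)
Lemma incr_unique (f g : 'I_n -> 'I_n) (T : eqType) (cl : 'I_n -> T) :
    (forall x y : 'I_n, x < y -> cl x = cl y -> f x < f y) ->
    (forall x y : 'I_n, x < y -> cl x = cl y -> g x < g y) ->
    (forall x, exists2 y, f x = g y & cl x = cl y) ->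
    (forall y, exists2 x, g y = f x & cl y = cl x) ->
  f =1 g.
Proof.
move=> incf incg fg gf x.
have [m] := ubnP (nat_of_ord x); elim: m x => // m IH x lt_x.
have IHx (z : 'I_n) : z < x -> f z = g z by move=> ltz; apply: IH; lia.
have [y fx cy] := fg x; have [z gx cz] := gf x.
case: (ltngtP y x) => [lt_yx|lt_xy|/val_inj eq_xy]; last by rewrite fx eq_xy.
  by have := incf _ _ lt_yx (esym cy); rewrite IHx // fx; lia.
case: (ltngtP z x) => [lt_zx|lt_xz|/val_inj eq_xz]; last by rewrite gx eq_xz.
  by have := incg _ _ lt_zx (esym cz); rewrite -IHx // gx; lia.
by have := incf _ _ lt_xz cz; have := incg _ _ lt_xy cy; rewrite -gx -fx; lia.
Qed.

(* The offset o is 0 for pipe dreams and n for bumpless ones; cl is the range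
   (below k or not) of the pipe of a given label. *)
Lemma lab_final (o : nat) (rho : 'S_n) (T : eqType) (cl : 'I_n -> T) :
    (forall x y : 'I_n, x < y -> cl x = cl y -> rho x < rho y) ->
    (forall y : 'I_n, exists x : 'I_n,
       lab D (n * n) (o + y) = o + x /\ cl x = cl (rho^-1 y)%g) ->
    (forall (x y : 'I_n) t, cl x = cl y -> ~~ swapped D (o + x) (o + y) t) ->
  forall y : 'I_n, lab D (n * n) (o + y) = o + (rho^-1 y)%g.
Proof.
move=> incr /fin_all_exists[F labF] nsw y.
have FK x : pos D (n * n) (o + F x) = o + x by have [<- _] := labF x; rewrite labK.
have clF x : cl (F x) = cl (rho^-1 x)%g by have [] := labF x.
have Finj : injective F.
  by move=> x x' eqF; apply: val_inj; have := FK x; rewrite eqF FK /=; lia.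
have [-> _] := labF y; congr (o + nat_of_ord _); move: y.
(* Labels of one class are never exchanged, so [F] increases on each class of final numbers, as does
   the inverse of [rho]. *)
apply: (@incr_unique _ _ T (fun y => cl (rho^-1 y)%g)).
- move=> x x' lt_x; rewrite -!clF => eqc.
  have eqlt : (o + F x < o + F x') = (o + x < o + x').
    rewrite -(FK x) -(FK x').
    by apply: (@pos_keep_iff n D _ _ 0) => // t _; apply: nsw.
  by move: eqlt; rewrite !ltn_add2l => ->.
- move=> x x' lt_x eqc; case: (ltngtP (rho^-1 x)%g (rho^-1 x')%g) => // [lt_x'|/val_inj].
    by have := incr _ _ lt_x' (esym eqc); rewrite !permKV; lia.
  by move/perm_inj => eqx; rewrite eqx ltnn in lt_x.
- by move=> x; exists (rho (F x)); rewrite permK ?clF.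
- move=> x; exists (invF Finj (rho^-1 x)%g); first by rewrite f_invF.
  by rewrite -(clF (invF _ _)) f_invF.
Qed.

End Pipes.

(** * Permutations whose values form two ranges, each increasing in position *)

Section TwoColours.
Variables (n k : nat) (pi : 'S_n).
Hypothesis inv_mono : forall a b : 'I_n, a < b -> (a < k) = (b < k) ->
  (pi^-1 a)%g < (pi^-1 b)%g.
Implicit Types D E : 'M[tile]_n.

Lemma mono (x y : 'I_n) : x < y -> (pi x < k) = (pi y < k) -> pi x < pi y.
Proof.
move=> lt_xy eqk; case: (ltngtP (pi x) (pi y)) => // [lt_yx|/val_inj/perm_inj eq_xy].
  by have := inv_mono lt_yx (esym eqk); rewrite !permK; lia.
by rewrite eq_xy ltnn in lt_xy.
Qed.

(** * Reduced pipe dreams *)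

Lemma pd_tilingP D : reflect
  ((forall i j, D i j = Cross \/ D i j = Elbow) /\
   (forall i j : 'I_n, D i j = Cross -> i + j + 1 < n))
  (pd_tiling D).
Proof.
apply: (iffP forallP) => [tD | [tD bD] i].
  have {}tD i j := forallP (tD i) j.
  split=> i j; have /andP[cD bD] := tD i j.
    by case/orP: cD => /eqP; [left | right].
  by move=> Dij; rewrite ltnNge; apply: contraL bD => ->; rewrite Dij.
apply/forallP => j; have [Dij|->] := tD i j; last by rewrite eqxx orbT implybT.
by rewrite Dij eqxx /= leqNgt bD.
Qed.

(** A local form of membership in [PDred pi]: only the range of each strand is recorded, at the
    crosses and on the west border. *)
Definition pd_sorted E : Prop :=
  [/\ pd_tiling E,
      forall i j, E i j = Cross ->
        seg_lab E (side_of i j North) < k <= seg_lab E (side_of i j East)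
    & forall i j : 'I_n, j = 0 :> nat ->
        (seg_lab E (side_of i j West) < k) = (pi i < k)].

Lemma pd_pos_lt E t a : pd_tiling E -> a < n -> pos E t a < n.
Proof.
move=> /pd_tilingP[tE bE] lt_a; elim: t => //= t IH.
rewrite /swap_time; case: ifP => // st.
have [i [j [def_t sij]]] := straight_time_cell st.
have lt_ij : i + j + 1 < n by apply: bE; case: (tE i j) sij => ->.
have -> : cell_pos n t = i + j by rewrite def_t time_of_ordK.
by rewrite /swap_at; do ![case: ifP]; lia.
Qed.

Lemma pd_lab_lt E t x : pd_tiling E -> (lab E t x < n) = (x < n).
Proof.
move=> tE; apply/idP/idP => [lt_lab|]; first by rewrite -(labK E t x) pd_pos_lt.
move: tE => /pd_tilingP[tE bE]; elim: t x => //= t IH x lt_x; apply: IH.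
rewrite /swap_time; case: ifP => // st.
have [i [j [def_t sij]]] := straight_time_cell st.
have lt_ij : i + j + 1 < n by apply: bE; case: (tE i j) sij => ->.
have -> : cell_pos n t = i + j by rewrite def_t time_of_ordK.
by rewrite /swap_at; do ![case: ifP]; lia.
Qed.

Lemma pd_on_pipe E i j s (p : 'I_n) : pd_tiling E ->
  seg_lab E (side_of i j s) = p -> on_pipe (@pd_start n) E p (side_of i j s).
Proof.
move=> /pd_tilingP[tE _] labp.
have touchE i' j' s' : touch (E i' j') s' by case: (tE i' j') => ->.
have [||//|[q labq conq]|[i' labi _]] := @touched_entered n E _ _ i j s.
- by move=> *; apply: touchE.
- by move=> *; apply: touchE.
- by have <- : q = p by apply: val_inj; rewrite /= -labp -labq.
by have := ltn_ord p; rewrite -labp labi; lia.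
Qed.

Lemma pd_seg_lab E (p : 'I_n) e : on_pipe (@pd_start n) E p e -> seg_lab E e = p.
Proof.
move=> /seg_lab_connect <-; have ltp := ltn_ord p.
have [i i0] : exists i : 'I_n, i = 0 :> nat by apply: ord_of_nat; lia.
by rewrite (pd_start_side _ i0) seg_lab_top.
Qed.

(** A cross inverts its two labels for good, so they form an inversion of the inverse of [pi], and
    such an inversion has one value below [k] and the other not. *)
Lemma PDred_sorted E : E \in PDred pi -> pd_sorted E.
Proof.
rewrite inE => /and3P[tE rE /forallP pE].
have exitE (i j : 'I_n) : j = 0 :> nat -> seg_lab E (side_of i j West) = pi i.
  by move=> j0; rewrite -(pd_exit_side _ j0); apply: pd_seg_lab.
have labF (i : 'I_n) : lab E (n * n) i = pi i.
  have [j j0] : exists j : 'I_n, j = 0 :> nat.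
    by apply: ord_of_nat; have := ltn_ord i; lia.
  by rewrite -(exitE i j j0) seg_lab_left.
have posF (p : 'I_n) : pos E (n * n) p = (pi^-1 p)%g.
  by rewrite -{1}[p](permKV pi) -labF labK.
have [tE' bE] := pd_tilingP _ tE.
split=> // [i j Eij|i j j0]; last by rewrite exitE.
have ltij := bE _ _ Eij.
have [p defp] : exists p : 'I_n, p = seg_lab E (side_of i j North) :> nat.
  apply: ord_of_nat; rewrite seg_lab_north pd_lab_lt //; lia.
have [q defq] : exists q : 'I_n, q = seg_lab E (side_of i j East) :> nat.
  apply: ord_of_nat; rewrite seg_lab_east pd_lab_lt //; lia.
have [||||lt_pq lt_pos] :=
  @cross_inversion n E _ (@nat_of_ord n) val_inj rE _ _ i j p q Eij.
- by move=> *; apply: pd_on_pipe.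
- by move=> i' j' p' q'; case: (tE' i' j') => ->.
- by [].
- by [].
rewrite -defp -defq; move: lt_pos; rewrite !posF.
have := inv_mono lt_pq; lia.
Qed.

Lemma pd_sorted_swap E : pd_sorted E -> forall a b t, swapped E a b t -> a < k <= b.
Proof.
case=> /pd_tilingP[tE _] cE _ a b t sw.
have [i [j [def_t sij]]] : exists i j : 'I_n, t = time n i j /\ straight (E i j).
  by apply: straight_time_cell; case/and3P: sw.
move: sw; rewrite def_t swapped_ord => /and3P[_ /eqP-> /eqP->].
by apply: cE; case: (tE i j) sij => ->.
Qed.

(** Crosses only exchange labels of different ranges, in one direction. This gives reducedness and
    keeps the order inside each range, so the ranges on the west border determine the whole
    permutation. *)
Lemma pd_sorted_PDred E : pd_sorted E -> E \in PDred pi.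
Proof.
move=> sE; have [tE cE xE] := sE.
have labF (i : 'I_n) : lab E (n * n) i = pi i.
  have := @lab_final n E 0 pi^-1%g _ (fun x : 'I_n => x < k).
  rewrite invgK; apply=> // [y|x y t eqxy]; last first.
    by apply/negP => /(pd_sorted_swap sE); lia.
  have [x defx] : exists x : 'I_n, x = lab E (n * n) y :> nat.
    by apply: ord_of_nat; rewrite pd_lab_lt.
  exists x; split=> //.
  have [j j0] : exists j : 'I_n, j = 0 :> nat.
    by apply: ord_of_nat; have := ltn_ord y; lia.
  by rewrite defx -(seg_lab_left _ _ j0) xE.
rewrite inE tE /=; apply/andP; split.
  apply: (@reduced_of_swaps n E _ (@nat_of_ord n) (fun x => x < k)).
    by move=> p e /pd_seg_lab.
  by move=> t p q /(pd_sorted_swap sE); lia.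
apply/forallP => i.
have [j j0] : exists j : 'I_n, j = 0 :> nat.
  by apply: ord_of_nat; have := ltn_ord i; lia.
by rewrite (pd_exit_side _ j0); apply: pd_on_pipe; rewrite // seg_lab_left.
Qed.

(** * Reduced bumpless pipe dreams *)

Lemma bpd_tilingP D : reflect
  [/\ forall i j, D i j <> Elbow,
      forall i i' j : 'I_n, i' = i.+1 :> nat ->
        touch (D i j) South = touch (D i' j) North,
      forall i j j' : 'I_n, j' = j.+1 :> nat -> touch (D i j) East = touch (D i j') West
    & [/\ forall i j : 'I_n, i = 0 :> nat -> touch (D i j) North = false,
          forall i j : 'I_n, j = 0 :> nat -> touch (D i j) West = false,
          forall i j : 'I_n, i.+1 = n -> touch (D i j) South
        & forall i j : 'I_n, j.+1 = n -> touch (D i j) East]]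
  (bpd_tiling D).
Proof.
apply: (iffP and4P) => [[e v h b]|[e v h [bN bW bS bE]]].
  split=> [i j|i i' j eqi|i j j' eqj|].
  - exact/eqP/(forallP (forallP e i) j).
  - rewrite -!touchesE.
    by have := forallP (forallP (forallP v i) i') j; rewrite eqi eqxx => /eqP.
  - rewrite -!touchesE.
    by have := forallP (forallP (forallP h i) j) j'; rewrite eqj eqxx => /eqP.
  have {}b i j := forallP (forallP b i) j.
  split=> i j /eqP eq0; rewrite -touchesE; have /and4P[] := b i j; rewrite eq0 //.
    by move=> /negPf.
  by move=> _ /negPf.
split.
- by apply/forallP => i; apply/forallP => j; apply/eqP/e.
- apply/forallP => i; apply/forallP => i'; apply/forallP => j; apply/implyP => /eqP eqi.
  by rewrite !touchesE (v _ _ _ eqi).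
- apply/forallP => i; apply/forallP => j; apply/forallP => j'; apply/implyP => /eqP eqj.
  by rewrite !touchesE (h _ _ _ eqj).
apply/forallP => i; apply/forallP => j; rewrite !touchesE.
apply/and4P; split; apply/implyP => /eqP eq0.
- by rewrite bN.
- by rewrite bW.
- by rewrite bS.
- by rewrite bE.
Qed.

(** Being used by a pipe propagates as labels do, from no edge of the north border and all edges of
    the east border. *)
Lemma touch_lab D i j s : bpd_tiling D ->
  touch (D i j) s = (n <= seg_lab D (side_of i j s)).
Proof.
case/bpd_tilingP=> [e v h [bN _ _ bE]]; move: i j s.
apply: (seg_lab_col (B := leq n)) => // [i j|i j|i j i0|i j jn].
- by case: (D i j).
- by case: (D i j).
- by rewrite bN // leqNgt ltn_ord.
- by rewrite bE // leq_addr.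
Qed.

Lemma bpd_entered D i j s : bpd_tiling D -> touch (D i j) s ->
  exists2 i' : 'I_n, seg_lab D (side_of i j s) = n + i'
    & connect (linked D) (bpd_exit i') (side_of i j s).
Proof.
move=> tD tij; case/bpd_tilingP: (tD) => [e v h _].
have [||//|[p labp _]|//] := @touched_entered n D _ _ i j s.
- by move=> i1 i2 j' e' ; rewrite (v _ _ _ e').
- by move=> i' j1 j2 e' ; rewrite (h _ _ _ e').
by move: tij; rewrite touch_lab // labp leqNgt ltn_ord.
Qed.

(* The tiles that every bumpless pipe dream of pi has in the columns from k on. *)
Definition frozen (i j : 'I_n) : tile :=
  if pi i == j then RTile
  else if i < (pi^-1 j)%g then Horizontal
  else if pi i < j then Cross else Vertical.

(** The local form of membership in [BPD pi], with all freedom confined to the first [k] columns. *)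
Definition bpd_sorted D : Prop :=
  [/\ bpd_tiling D,
      forall i j : 'I_n, j < k -> D i j <> Cross
    & forall i j : 'I_n, k <= j -> D i j = frozen i j].

Lemma pi_inv_eq (i j : 'I_n) : ((pi^-1 j)%g == i) = (pi i == j).
Proof. by rewrite -(inj_eq (@perm_inj _ pi)) permKV eq_sym. Qed.

Lemma frozen_touch (i j : 'I_n) : k <= j ->
  [/\ touch (frozen i j) North = ((pi^-1 j)%g < i),
      touch (frozen i j) South = ((pi^-1 j)%g <= i),
      touch (frozen i j) West = (pi i < j)
    & touch (frozen i j) East = (pi i <= j)].
Proof.
move=> le_kj; rewrite /frozen; case: eqP => [<-|ne_ij].
  by rewrite permK /= ltnn ltnn !leqnn.
have ne_i : nat_of_ord (pi^-1 j)%g <> i.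
  by move=> /val_inj/eqP; rewrite pi_inv_eq => /eqP.
have ne_j : nat_of_ord (pi i) <> j by move=> /val_inj.
case: ifP => [lt_i|].
  (* The opposite order would be an inversion of two values at least [k]; hence no blank of the
     Rothe diagram lies in these columns. *)
  have lt_ij : pi i < j.
    case: (ltngtP (pi i) j) => // gt_ij.
    have := inv_mono gt_ij; rewrite permK; lia.
  by rewrite /= ; split; lia.
by case: ifP => /= *; split; lia.
Qed.

Lemma bpd_start_lab D (p : 'I_n) : has_perm (@bpd_start n) (@bpd_exit n) D pi ->
  seg_lab D (bpd_start p) = n + (pi^-1 p)%g.
Proof.
move=> /forallP/(_ (pi^-1 p)%g); rewrite permKV => /seg_lab_connect ->.
have ltp := ltn_ord p.
have [j jn] : exists j : 'I_n, j = n.-1 :> nat by apply: ord_of_nat; lia.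
have jn' : j.+1 = n by lia.
by rewrite (bpd_exit_side _ jn') seg_lab_right.
Qed.

Lemma bpd_on_pipe D i j s (p : 'I_n) : bpd_tiling D ->
    has_perm (@bpd_start n) (@bpd_exit n) D pi ->
  seg_lab D (side_of i j s) = n + (pi^-1 p)%g ->
  on_pipe (@bpd_start n) D p (side_of i j s).
Proof.
move=> tD /forallP pD labp.
have [|i' labi con] := @bpd_entered D i j s tD.
  by rewrite touch_lab // labp leq_addr.
have <- : pi i' = p.
  by apply/eqP; rewrite -pi_inv_eq; apply/eqP/val_inj => /=; lia.
exact: connect_trans (pD i') con.
Qed.

(** The column is forced upwards from the south border. Pipe [j] climbs straight while its label
    differs from that of the east edge; in its exit row the two labels agree, which rules out a
    cross and leaves an r-tile. Above that row only horizontal tiles fit. *)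
Lemma frozen_column D (j : 'I_n) : k <= j -> bpd_tiling D ->
    has_perm (@bpd_start n) (@bpd_exit n) D pi ->
    (forall i, touch (D i j) East = (pi i <= j)) ->
    (forall i, pi i <= j -> seg_lab D (side_of i j East) = n + i) ->
  forall i, D i j = frozen i j.
Proof.
move=> le_kj tD pD tE lE; case/bpd_tilingP: (tD) => [e v _ [_ _ bS _]].
suff H m : forall i : 'I_n, n - i < m -> D i j = frozen i j /\
    ((pi^-1 j)%g <= i -> seg_lab D (side_of i j South) = n + (pi^-1 j)%g).
  by move=> i; have [] := H _ i (ltnSn _).
elim: m => // m IH i lt_m.
have [tS lS] : touch (D i j) South = ((pi^-1 j)%g <= i) /\
    ((pi^-1 j)%g <= i -> seg_lab D (side_of i j South) = n + (pi^-1 j)%g).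
  have lti := ltn_ord i.
  case: (ltnP i.+1 n) => [lt_i|le_i]; last first.
    have i_n : i.+1 = n by lia.
    rewrite bS //; split; first by have := ltn_ord (pi^-1 j)%g; lia.
    by rewrite -(bpd_start_side _ i_n) bpd_start_lab.
  have [i' def_i'] := ord_of_nat lt_i.
  have [|D' lS'] := IH i'; first lia.
  rewrite (v _ _ _ def_i') D' (side_of_SN _ def_i').
  have [-> _ _ _] := frozen_touch i' le_kj; split; first lia.
  move=> le_i; rewrite -lS'; last lia.
  have [|//] := @seg_lab_straight n D i' j.
  rewrite D' /frozen; have -> : pi i' == j = false.
    by rewrite -pi_inv_eq; apply/eqP => /(congr1 (@nat_of_ord n)); lia.
  by do ![case: ifP].
split=> //.
have tEi := tE i.
have eqij : (pi i == j) = (nat_of_ord (pi^-1 j)%g == i).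
  by rewrite -pi_inv_eq.
have eqij' : (pi i == j) = (nat_of_ord (pi i) == j) by [].
rewrite /frozen; case: ifP => [eq_ij|ne_ij].
  have {}eqij : (pi^-1 j)%g = i :> nat by apply/eqP; rewrite -eqij.
  have {}eqij' : pi i = j :> nat by apply/eqP.
  have := seg_lab_NE D i j; have := @seg_lab_straight n D i j.
  move: tEi tS lS; rewrite eqij leqnn lE ?eqij' ?leqnn //.
  case: (D i j) (e i j) => //= _ _ _ -> // [] // _ <-; by rewrite eqxx.
have := lE i; have := @seg_lab_turn n D i j; move: tEi tS lS.
case: ifP => [lt_i|].
  have [_ _ ] := frozen_touch i le_kj; rewrite /frozen ne_ij lt_i /= => _ lt_ij.
  have -> : pi i <= j by lia.
  have -> : (pi^-1 j)%g <= i = false by lia.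
  by case: (D i j) (e i j).
move=> ge_i.
have -> : (pi^-1 j)%g <= i by lia.
case: (ltnP (pi i) j) => [lt_ij|ge_ij].
  have -> : pi i <= j by lia.
  case: (D i j) (e i j) => //= _ _ _ /(_ isT) lS [//|_ lSE] /(_ isT) lE'.
  by move: eqij; rewrite ne_ij -(eqn_add2l n) -lS -lE' lSE eqxx.
have ne_ij' : nat_of_ord (pi i) <> j by move/val_inj/eqP; rewrite ne_ij.
have -> : pi i <= j = false by lia.
by case: (D i j) (e i j).
Qed.

(** Columns are forced one after the other from the east border. The bound [k <= j.+1] also admits
    column [k - 1], to obtain the edges through which pipes leave the free columns. *)
Lemma bpd_right D : bpd_tiling D -> has_perm (@bpd_start n) (@bpd_exit n) D pi ->
  forall i j : 'I_n, k <= j.+1 -> 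
    (k <= j -> D i j = frozen i j) /\
    (touch (D i j) East = (pi i <= j)) /\
    (pi i <= j -> seg_lab D (side_of i j East) = n + i).
Proof.
move=> tD pD; case/bpd_tilingP: (tD) => [e _ h [_ _ _ bE]].
suff H m : forall j : 'I_n, n - j < m -> k <= j.+1 -> forall i,
    (k <= j -> D i j = frozen i j) /\
    (touch (D i j) East = (pi i <= j)) /\
    (pi i <= j -> seg_lab D (side_of i j East) = n + i).
  by move=> i j le_k; apply: (H _ j (ltnSn _)).
elim: m => // m IH j lt_m le_k i.
have HE i' : (touch (D i' j) East = (pi i' <= j)) /\
    (pi i' <= j -> seg_lab D (side_of i' j East) = n + i').
  have ltj := ltn_ord j.
  case: (ltnP j.+1 n) => [lt_j|le_j]; last first.
    have jn : j.+1 = n by lia.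
    by rewrite bE // seg_lab_right //; split=> //; have := ltn_ord (pi i'); lia.
  have [j' def_j'] := ord_of_nat lt_j.
  have le_kj' : k <= j' by lia.
  have [||/(_ le_kj') D' [tE lE]] := IH j' _ _ i'; [lia|lia|].
  have [_ _ tW _] := frozen_touch i' le_kj'.
  rewrite (h _ _ _ def_j') D' tW (side_of_EW _ def_j'); split; first lia.
  move=> le_i'; rewrite -lE; last lia.
  have [|//] := @seg_lab_straight n D i' j'.
  move: D' tW; rewrite /frozen; case: eqP => // _ ->; first by move=> /= ; lia.
  by do ![case: ifP].
split; last by [].
by move=> le_kj; apply: frozen_column => // i'; have [] := HE i'.
Qed.

Lemma BPD_sorted D : D \in BPD pi -> bpd_sorted D.
Proof.
rewrite inE => /and3P[tD rD pD].
have [e v h [bN bW bS bE]] := bpd_tilingP _ tD.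
have R := bpd_right tD pD.
split=> // [i j lt_jk Dij|i j le_kj]; last by have [/(_ le_kj)] := R i j (leqW le_kj).
(* In the first [k] columns only pipes with values below [k] occur; a cross there would invert two
   of them, against [mono]. *)
have small : forall (i j : 'I_n) s, j < k -> touch (D i j) s ->
    exists2 i' : 'I_n, seg_lab D (side_of i j s) = n + i' & pi i' < k.
  apply: (@grid_ind n (fun i j s => j < k -> touch (D i j) s ->
    exists2 i' : 'I_n, seg_lab D (side_of i j s) = n + i' & pi i' < k)).
  - by move=> i1 j1 i0 _; rewrite bN.
  - move=> i1 j1 jn lt_j tE; exists i1; first exact: seg_lab_right.
    by have := ltn_ord (pi i1); lia.
  - move=> i1 i2 j1 eqi IH lt_j tN; rewrite -(side_of_SN _ eqi).
    by apply: IH; rewrite ?(v _ _ _ eqi).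
  - move=> i1 j1 j2 eqj IH lt_j tE.
    case: (ltnP j2 k) => [lt_j2|le_j2].
      by rewrite (side_of_EW _ eqj); apply: IH; rewrite // -(h _ _ _ eqj).
    have [|_ [tE' lE']] := R i1 j1; first lia.
    by exists i1; [apply: lE'; rewrite -tE' | rewrite tE' in tE; lia].
  move=> i1 j1 hN hE; have := @seg_lab_straight n D i1 j1.
  have := @seg_lab_turn n D i1 j1.
  by case: (D i1 j1) (e i1 j1) hN hE => // _ hN hE T S;
    first [have [hW hS] := S isT | have [hW hS] := T isT];
    split=> // lt_j _; rewrite ?hW ?hS; first [exact: hN | exact: hE].
have [a labN sa] := small i j North lt_jk (congr1 (touch^~ North) Dij).
have [b labE sb] := small i j East lt_jk (congr1 (touch^~ East) Dij).
have lp_inj : injective (fun p : 'I_n => n + (pi^-1 p)%g).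
  by move=> x y /addnI/val_inj/perm_inj.
have := @cross_inversion n D _ _ lp_inj rD _ _ i j (pi a) (pi b) Dij.
rewrite !permK; case=> //.
- by move=> *; apply: bpd_on_pipe.
- move=> i' j' p q sij lN lE.
  have tN : touch (D i' j') North by rewrite touch_lab // lN leq_addr.
  have tE : touch (D i' j') East by rewrite touch_lab // lE leq_addr.
  by case: (D i' j') sij tN tE.
have posF (x : 'I_n) : pos D (n * n) (n + x) = n + pi x.
  have ltx := ltn_ord x.
  have [i' in'] : exists i' : 'I_n, i' = n.-1 :> nat by apply: ord_of_nat; lia.
  have {}in' : i'.+1 = n by lia.
  have := bpd_start_lab (pi x) pD.
  by rewrite permK (bpd_start_side _ in') seg_lab_bottom // => <-; rewrite labK.
rewrite !posF => lt_ab lt_pos.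
have := @mono a b; lia.
Qed.

Lemma bpd_sorted_BPD D : bpd_sorted D -> D \in BPD pi.
Proof.
move=> [tD lD rD]; have [e v h [bN bW bS bE]] := bpd_tilingP _ tD.
(* A geometric description of the edges on pipes with value at least [k]: in the columns from [k]
   on, all used vertical edges, and the used horizontal ones in rows that such pipes leave. *)
pose large (i j : 'I_n) s := touch (D i j) s && (k <= j) &&
  match s with North | South => true | _ => k <= pi i end.
have largeE i j s : large i j s =
    [exists i' : 'I_n, (seg_lab D (side_of i j s) == n + i') && (k <= pi i')].
  move: i j s.
  apply: (seg_lab_col (B := fun x => [exists i' : 'I_n, (x == n + i') && (k <= pi i')])).
  - by move=> i i' j eqi; rewrite /large (v _ _ _ eqi).
  - move=> i j j' eqj; rewrite /large (h _ _ _ eqj).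
    case: (ltngtP j k) => [lt_jk|gt_jk|eq_jk].
    + case: (leqP k j') => [le_kj'|]; last by rewrite !andbF.
      have [_ _ tW _] := frozen_touch i le_kj'.
      rewrite (rD _ _ le_kj') tW; lia.
    + by have -> : k <= j' by lia.
    + by have -> : k <= j' by lia.
  - move=> i j; rewrite /large; case: (leqP k j) => [le_kj|]; last by rewrite !andbF.
    by case: (D i j).
  - move=> i j; rewrite /large; case: (leqP k j) => [le_kj|]; last by rewrite !andbF.
    rewrite (rD _ _ le_kj) /frozen; case: eqP => [->|_]; first by rewrite /= le_kj.
    by do ![case: ifP].
  - move=> i j i0; rewrite /large bN //; symmetry; apply/existsP => -[i' /andP[/eqP]].
    by have := ltn_ord j; lia.
  move=> i j jn; rewrite /large bE //=; apply/idP/existsP => [/andP[_ le_k]|[i' /andP[]]].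
    by exists i; rewrite eqxx.
  rewrite eqn_add2l => /eqP/val_inj <- le_k.
  by rewrite le_k andbT; have := ltn_ord (pi i); lia.
(* An exchange of two used labels is a cross, so it lies in a frozen column and its vertical strand
   is large. A large horizontal strand would give an inversion inside the upper range. *)
have sw_class (a b : 'I_n) t : swapped D (n + a) (n + b) t -> (k <= pi a) && (pi b < k).
  move=> sw.
  have [i [j [def_t sij]]] : exists i j : 'I_n, t = time n i j /\ straight (D i j).
    by apply: straight_time_cell; case/and3P: sw.
  move: sw; rewrite def_t swapped_ord => /and3P[_ /eqP lN /eqP lE].
  have tN : touch (D i j) North by rewrite touch_lab // -lN leq_addr.
  have tE : touch (D i j) East by rewrite touch_lab // -lE leq_addr.
  have Dij : D i j = Cross by case: (D i j) sij tN tE.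
  have le_kj : k <= j by rewrite leqNgt; apply/negP => lt_jk; case: (lD _ _ lt_jk Dij).
  have /existsP[a' /andP[/eqP]] : [exists i' : 'I_n,
      (seg_lab D (side_of i j North) == n + i') && (k <= pi i')].
    by rewrite -largeE /large tN le_kj.
  rewrite -lN => /addnI/val_inj <- ->; rewrite ltnNge; apply/negP => le_kb.
  have : large i j East by rewrite largeE; apply/existsP; exists b; rewrite -lE eqxx.
  rewrite /large => /andP[_ le_ki].
  have := rD i j le_kj; rewrite Dij /frozen; case: eqP => // ne_ij.
  have ne_ij' : nat_of_ord (pi i) <> j by move=> /val_inj.
  case: ifP => // ge_i; case: ifP => // lt_ij _.
  have : (pi^-1 (pi i))%g < (pi^-1 j)%g by apply: inv_mono => //; lia.
  by rewrite permK; lia.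
have labF (p : 'I_n) : lab D (n * n) (n + p) = n + (pi^-1 p)%g.
  apply: (@lab_final n D n pi _ (fun x : 'I_n => pi x < k)).
  - by apply: mono.
  - move=> y; have lty := ltn_ord y.
    have [i i_n] : exists i : 'I_n, i = n.-1 :> nat by apply: ord_of_nat; lia.
    have {}i_n : i.+1 = n by lia.
    have [x labx _] := bpd_entered tD (bS i y i_n).
    exists x; rewrite -(seg_lab_bottom _ _ i_n) labx; split=> //.
    have := largeE i y South; rewrite labx /large bS //= andbT permKV !ltnNge => ->.
    congr (~~ _).
    apply/idP/existsP => [le_k|[x' /andP[]]]; first by exists x; rewrite eqxx.
    by rewrite eqn_add2l => /eqP/val_inj ->.
  by move=> x y t eqk; apply/negP => /sw_class; lia.
have startE (p : 'I_n) : exists2 i : 'I_n, i.+1 = n & bpd_start p = side_of i p South.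
  have ltp := ltn_ord p.
  have [i i_n] : exists i : 'I_n, i = n.-1 :> nat by apply: ord_of_nat; lia.
  have {}i_n : i.+1 = n by lia.
  by exists i => //; rewrite (bpd_start_side _ i_n).
rewrite inE tD /=; apply/andP; split.
  apply: (@reduced_of_swaps n D _ (fun p : 'I_n => n + (pi^-1 p)%g) (fun p => k <= p)).
    move=> p e' /seg_lab_connect <-; have [i i_n ->] := startE p.
    by rewrite seg_lab_bottom // labF.
  by move=> t p q /sw_class; rewrite !permKV -ltnNge.
apply/forallP => i; rewrite /on_pipe connect_linkedC.
have [i' i_n ->] := startE (pi i).
have [x labx con] := bpd_entered tD (bS i' (pi i) i_n).
have eq_xi : x = i.
  by apply: val_inj; move: labx; rewrite seg_lab_bottom // labF permK /=; lia.
by rewrite eq_xi in con.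
Qed.

(** * The mirror map *)

Hypothesis le_kn : k <= n.

(** Fixing the columns from [k] on makes the reflection an involution of all columns, by which
    products over cells can be reindexed. *)
Definition mirror (c : 'I_n) : 'I_n := insubd c (if c < k then k.-1 - c else c).

Lemma val_mirror (c : 'I_n) : mirror c = (if c < k then k.-1 - c else c) :> nat.
Proof. by rewrite val_insubd; have := ltn_ord c; do ![case: ifP]; lia. Qed.

Lemma mirrorK : involutive mirror.
Proof. by move=> c; apply: val_inj; rewrite /= !val_mirror; do ![case: ifP]; lia. Qed.

Lemma mirror_lt (c : 'I_n) : (mirror c < k) = (c < k).
Proof. by rewrite val_mirror; case: ifP; lia. Qed.

Definition pd_of D : 'M[tile]_n :=
  (\matrix_(i, c) if D i (mirror c) == Blank then Cross else Elbow)%R.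

Lemma pd_of_cross D i c : (pd_of D i c == Cross) = (D i (mirror c) == Blank).
Proof. by rewrite mxE; case: ifP. Qed.

Lemma pd_of_elbow D i c : (pd_of D i c == Elbow) = (D i (mirror c) != Blank).
Proof. by rewrite mxE; case: ifP. Qed.

Lemma pd_of_wt D : pd_wt (pd_of D) = bpd_wt D.
Proof.
rewrite /pd_wt /bpd_wt.
have hK : involutive (fun x : 'I_n * 'I_n => (x.1, mirror x.2)).
  by case=> i c; rewrite /= mirrorK.
rewrite (reindex_inj (can_inj hK)) /=; apply: eq_big => // -[i c] /=.
by rewrite pd_of_cross mirrorK.
Qed.

Lemma blank_left D i j : bpd_sorted D -> D i j = Blank -> j < k.
Proof.
case=> _ _ rD; apply: contra_eqT; rewrite -leqNgt => /rD ->.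
by rewrite /frozen; do ![case: ifP].
Qed.

Lemma bpd_exit_col D (i j : 'I_n) : bpd_sorted D -> j.+1 = k ->
  touch (D i j) East = (pi i < k).
Proof.
case=> tD _ rD jk; have [_ _ h [_ _ _ bE]] := bpd_tilingP _ tD.
case: (ltnP j.+1 n) => [lt_j|le_j].
  have [j' def_j'] := ord_of_nat lt_j.
  have le_kj' : k <= j' by lia.
  have [_ _ tW _] := frozen_touch i le_kj'.
  by rewrite (h _ _ _ def_j') rD // tW; lia.
have ltj := ltn_ord j; rewrite bE; last lia.
by have := ltn_ord (pi i); lia.
Qed.

(* The strands of [pd_of D] entering in the first k columns run through the
   horizontal edges that D uses and the vertical edges that D avoids. *)
Definition small_side D (i c : 'I_n) (s : side) : bool :=
  (c < k) && match s with
             | North => ~~ touch (D i (mirror c)) North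
             | South => ~~ touch (D i (mirror c)) South
             | West => touch (D i (mirror c)) East
             | East => touch (D i (mirror c)) West
             end.

(** A tile other than a cross or a blank touches exactly one of north and east and exactly one of
    south and west, which is the elbow rule for [small_side]; a blank touches nothing, which gives
    the rule of a cross. *)
Lemma small_sideE D i c s : bpd_sorted D ->
  small_side D i c s = (seg_lab (pd_of D) (side_of i c s) < k).
Proof.
move=> sD; have [tD lD rD] := sD; have [e v h [bN bW bS bE]] := bpd_tilingP _ tD.
move: i c s; apply: (seg_lab_col (B := fun x => x < k)).
- by move=> i i' c eqi; rewrite /small_side (v _ _ _ eqi).
- move=> i c c' eqc; rewrite /small_side.
  case: (ltnP c' k) => [lt_c'|le_c'].
    have -> : c < k by lia.
    have eqm : mirror c = (mirror c').+1 :> nat.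
      by rewrite !val_mirror; do ![case: ifP]; lia.
    by rewrite (h _ _ _ eqm).
  case: (ltnP c k) => //= lt_c; rewrite bW //.
  by rewrite val_mirror lt_c; lia.
- move=> i c; rewrite mxE /small_side; case: eqP => // ->; by rewrite !andbF.
- move=> i c; rewrite mxE /small_side; case: eqP => // neB _.
  case: (ltnP c k) => //; rewrite -mirror_lt => lt_c.
  have := lD i _ lt_c; case: (D i (mirror c)) (e i (mirror c)) neB => //.
- by move=> i c i0; rewrite /small_side bN // andbT.
move=> i c cn; rewrite /small_side.
have -> : n + i < k = false by lia.
case: (ltnP c k) => //= lt_c; rewrite bW // val_mirror lt_c; lia.
Qed.

(** No cross has a label below [k] on its horizontal strand, so such a label is only ever moved to
    the next larger number. *)
Lemma pd_of_lab_pos_mono D a t1 t2 : bpd_sorted D -> a < k -> t1 <= t2 ->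
  pos (pd_of D) t1 a <= pos (pd_of D) t2 a.
Proof.
move=> sD lt_a; elim: t2 => [|t2 IH]; first by rewrite leqn0 => /eqP ->.
rewrite leq_eqVlt => /orP[/eqP -> //|lt_t].
have {}IH := IH lt_t; apply: leq_trans IH _ => /=.
rewrite /swap_time; case: ifP => // st.
have [i [c [def_t sij]]] := straight_time_cell st.
rewrite /swap_at; case: eqP => [->|_]; first by lia.
case: eqP => // pos_a; exfalso.
have := small_sideE i c East sD; rewrite seg_lab_east.
have -> : (i + c).+1 = (cell_pos n t2).+1 by rewrite def_t time_of_ordK.
rewrite -def_t -pos_a posK lt_a /small_side.
by move: sij; rewrite mxE; case: eqP => // ->; rewrite andbF.
Qed.

Lemma pd_of_sorted D : bpd_sorted D -> pd_sorted (pd_of D).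
Proof.
move=> sD; have [tD lD rD] := sD; have [e v h [bN bW bS bE]] := bpd_tilingP _ tD.
have crossP i c : pd_of D i c = Cross -> c < k /\ D i (mirror c) = Blank.
  move=> /eqP; rewrite pd_of_cross => /eqP Dic; split=> //.
  by rewrite -mirror_lt; apply: blank_left Dic.
have sideP i c : pd_of D i c = Cross ->
    seg_lab (pd_of D) (side_of i c North) < k <= seg_lab (pd_of D) (side_of i c East).
  move=> /crossP[lt_c Dic]; rewrite [k <= _]leqNgt -!small_sideE // /small_side.
  by rewrite lt_c Dic.
split=> //.
  apply/pd_tilingP; split=> [i c|i c Eic].
    by rewrite mxE; case: ifP; [left | right].
  (* After the cross its small label [a] has number [i + c + 1], which never decreases. A final
     number [x] at least [n] would put [a] on the south border, all of whose edges are used by [D];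
     so [i + c + 1 < n]. *)
  have /andP[lt_a _] := sideP i c Eic.
  set a := seg_lab _ _ in lt_a.
  have ltc := ltn_ord c; have lti := ltn_ord i.
  have tb := time_bound i c.
  have pos1 : pos (pd_of D) (time n i c).+1 a = (i + c).+1.
    rewrite /a; have [_ <-] := @seg_lab_straight n (pd_of D) i c
      (etrans (congr1 _ Eic) erefl).
    by rewrite seg_lab_south labK.
  have := pd_of_lab_pos_mono sD lt_a tb; rewrite pos1.
  have : pos (pd_of D) (n * n) a < n + n by apply: pos_bound; lia.
  set x := pos _ _ _ => lt_x le_x.
  suff : x < n by lia.
  rewrite ltnNge; apply/negP => le_nx.
  have [j def_j] : exists j : 'I_n, j = x - n :> nat by apply: ord_of_nat; lia.
  have [i' i_n] : exists i' : 'I_n, i' = n.-1 :> nat by apply: ord_of_nat; lia.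
  have {}i_n : i'.+1 = n by lia.
  have := small_sideE i' j South sD; rewrite seg_lab_bottom //.
  have -> : n + j = x by lia.
  by rewrite /x posK lt_a /small_side bS // andbF.
move=> i c c0; rewrite -small_sideE // /small_side.
case: (ltnP c k) => [lt_c|le_c]; last by have -> : k = 0 by lia.
by rewrite (bpd_exit_col _ sD) // val_mirror lt_c; lia.
Qed.

Lemma tile_eq t1 t2 : t1 <> Cross -> t1 <> Elbow -> t2 <> Cross -> t2 <> Elbow ->
  (forall s, touch t1 s = touch t2 s) -> t1 = t2.
Proof.
move=> c1 e1 c2 e2 eqt; move: (eqt North) (eqt South) (eqt West) (eqt East).
by case: t1 c1 e1 {eqt} => //; case: t2 c2 e2.
Qed.

(** The labels below [k] in the image tell which sides each tile of the first [k] columns touches,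
    and this determines a tile that is neither a cross nor an elbow. *)
Lemma pd_of_inj D1 D2 : bpd_sorted D1 -> bpd_sorted D2 -> pd_of D1 = pd_of D2 -> D1 = D2.
Proof.
move=> s1 s2 eqE; have [t1 l1 r1] := s1; have [t2 l2 r2] := s2.
have [e1 _ _ _] := bpd_tilingP _ t1; have [e2 _ _ _] := bpd_tilingP _ t2.
apply/matrixP => i j; case: (leqP k j) => [le_kj|lt_jk]; first by rewrite r1 ?r2.
have eqs s : small_side D1 i (mirror j) s = small_side D2 i (mirror j) s.
  by rewrite !small_sideE // eqE.
apply: tile_eq => [|||| s]; rewrite ?(l1 _ _ lt_jk) ?(l2 _ _ lt_jk) //.
- exact: l1.
- exact: l2.
move: eqs; rewrite /small_side mirror_lt lt_jk mirrorK /= => eqs.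
case: s; [apply: negb_inj; exact: (eqs North) | apply: negb_inj; exact: (eqs South)
  | exact: (eqs East) | exact: (eqs West)].
Qed.

(** The inverse of [pd_of]: a label below [k] to the north means an avoided north side, and one to
    the east means, after mirroring, a used west side. *)
Definition bpd_of E : 'M[tile]_n :=
  (\matrix_(i < n, j < n) if (k <= j)%N then frozen i j
     else if E i (mirror j) == Cross then Blank
     else match (seg_lab E (side_of i (mirror j) North) < k)%N,
                (seg_lab E (side_of i (mirror j) East) < k)%N with
          | true, true => Horizontal
          | true, false => RTile
          | false, true => JTile
          | false, false => Vertical
          end)%R.

Lemma bpd_of_touch E (i j : 'I_n) : pd_sorted E -> j < k ->
  [/\ touch (bpd_of E i j) North = ~~ (seg_lab E (side_of i (mirror j) North) < k),
      touch (bpd_of E i j) South = ~~ (seg_lab E (side_of i (mirror j) South) < k),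
      touch (bpd_of E i j) West = (seg_lab E (side_of i (mirror j) East) < k)
    & touch (bpd_of E i j) East = (seg_lab E (side_of i (mirror j) West) < k)].
Proof.
move=> [tE cE _] lt_jk; rewrite mxE [k <= j]leqNgt lt_jk.
have := @seg_lab_straight n E i (mirror j); have := @seg_lab_turn n E i (mirror j).
have := cE i (mirror j); have [tE' _] := pd_tilingP _ tE.
case: (tE' i (mirror j)) => -> cr.
  move=> _ [] // -> ->; have /andP[lt_N le_E] := cr erefl.
  by rewrite lt_N [_ (side_of _ _ East) < k]ltnNge le_E.
case=> // -> -> _ /=.
by case: (_ < k); case: (_ < k).
Qed.

(** Labels travel only left and down, so a label found in these columns entered there from the
    north, or from the east border. *)
Lemma seg_lab_ge E (i j : 'I_n) s : k <= j -> k <= seg_lab E (side_of i j s).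
Proof.
move: i j s; apply: grid_ind.
- by move=> i j i0; rewrite seg_lab_top.
- by move=> i j jn _; rewrite seg_lab_right //; apply: leq_trans le_kn (leq_addr _ _).
- by move=> i i' j eqi; rewrite (side_of_SN _ eqi).
- by move=> i j j' eqj; rewrite (side_of_EW _ eqj) => IH le_j; apply: IH; lia.
move=> i j hN hE; case: (boolP (straight (E i j))) => sij.
  by have [-> ->] := seg_lab_straight sij.
by have [-> ->] := seg_lab_turn sij.
Qed.

Lemma bpd_of_sorted E : pd_sorted E -> bpd_sorted (bpd_of E).
Proof.
move=> sE; have [tE cE xE] := sE; have [tE' bE'] := pd_tilingP _ tE.
have rightE (i j : 'I_n) : k <= j -> bpd_of E i j = frozen i j.
  by move=> le_kj; rewrite mxE le_kj.
have tch (i j : 'I_n) := @bpd_of_touch E i j sE.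
split=> //; last first.
  move=> i j lt_jk; rewrite mxE leqNgt lt_jk.
  by case: eqP => // _; case: (_ < k); case: (_ < k).
have eE i j : bpd_of E i j <> Elbow.
  rewrite mxE /frozen; do ![case: ifP => // _].
apply/bpd_tilingP; split=> // [i i' j eqi|i j j' eqj|].
- case: (leqP k j) => [le_kj|lt_jk]; last first.
    have [_ -> _ _] := tch i j lt_jk; have [-> _ _ _] := tch i' j lt_jk.
    by rewrite (side_of_SN _ eqi).
  rewrite !rightE //; have [_ -> _ _] := frozen_touch i le_kj.
  by have [-> _ _ _] := frozen_touch i' le_kj; rewrite eqi.
- case: (leqP k j) => [le_kj|lt_jk].
    have le_kj' : k <= j' by lia.
    rewrite !rightE //; have [_ _ _ ->] := frozen_touch i le_kj.
    by have [_ _ -> _] := frozen_touch i le_kj'; rewrite eqj.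
  have [_ _ _ ->] := tch i j lt_jk; case: (leqP k j') => [le_kj'|lt_j'].
    rewrite xE; last by rewrite val_mirror lt_jk; lia.
    rewrite rightE //; have [_ _ -> _] := frozen_touch i le_kj'; lia.
  have [_ _ -> _] := tch i j' lt_j'.
  rewrite (@side_of_EW n i (mirror j') (mirror j)) //.
  by rewrite !val_mirror lt_jk lt_j'; lia.
split=> i j eq0; (case: (leqP k j) => [le_kj|lt_jk]; [rewrite rightE // | ]).
- by have [-> _ _ _] := frozen_touch i le_kj; rewrite eq0.
- have [-> _ _ _] := tch i j lt_jk.
  by rewrite seg_lab_top // mirror_lt lt_jk.
- by have [_ _ -> _] := frozen_touch i le_kj; rewrite eq0.
- have [_ _ -> _] := tch i j lt_jk; apply/negbTE; rewrite -leqNgt.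
  have ltm := ltn_ord (mirror j).
  case: (ltnP (mirror j).+1 n) => [lt_m|le_m].
    have [c def_c] := ord_of_nat lt_m.
    rewrite (side_of_EW _ def_c); apply: seg_lab_ge.
    by rewrite def_c val_mirror lt_jk; lia.
  rewrite seg_lab_right; lia.
- have [_ -> _ _] := frozen_touch i le_kj.
  by have := ltn_ord (pi^-1 j)%g; lia.
- have [_ -> _ _] := tch i j lt_jk; rewrite -leqNgt seg_lab_bottom //.
  by apply: leq_trans le_kn _; rewrite leqNgt pd_lab_lt // -leqNgt leq_addr.
- have [_ _ _ ->] := frozen_touch i le_kj.
  by have := ltn_ord (pi i); lia.
have [_ _ _ ->] := tch i j lt_jk; rewrite xE; last by rewrite val_mirror lt_jk; lia.
by have := ltn_ord (pi i); lia.
Qed.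

Lemma bpd_ofK E : pd_sorted E -> pd_of (bpd_of E) = E.
Proof.
move=> sE; have [tE cE xE] := sE; have [tE' bE'] := pd_tilingP _ tE.
apply/matrixP => i c; rewrite mxE mxE mirrorK.
case: (leqP k (mirror c)) => [le_m|lt_m].
  have le_c : k <= c by rewrite leqNgt -mirror_lt -leqNgt.
  have := seg_lab_ge E i North le_c; have := cE i c.
  case: (tE' i c) => -> //; first by move=> /(_ erefl); lia.
  by rewrite /frozen; do ![case: ifP].
by case: (tE' i c) => -> //=; case: (_ < k); case: (_ < k).
Qed.

(** * Droops and slides *)

Section Droop.
Variables (D : 'M[tile]_n) (i i' j j' : 'I_n).
Hypotheses (sD : bpd_sorted D) (eqi : i' = i.+1 :> nat) (eqj : j' = j.+1 :> nat).
Hypotheses (Dij : D i j = RTile) (Dij' : D i' j' = Blank).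
Let D' := droop_at D i i' j j'.

Let ne_i : i' == i = false. Proof. by apply/eqP => /(congr1 (@nat_of_ord n)); lia. Qed.
Let ne_j : j' == j = false. Proof. by apply/eqP => /(congr1 (@nat_of_ord n)); lia. Qed.
Let lt_j' : j' < k. Proof. exact: (blank_left sD Dij'). Qed.

Lemma droop_corners : (D i' j = Vertical \/ D i' j = JTile) /\
                      (D i j' = Horizontal \/ D i j' = JTile).
Proof.
have [tD lD _] := sD; have [e v h _] := bpd_tilingP _ tD.
have lt_j : j < k by lia.
split.
  have := v _ _ j eqi; have := h i' _ _ eqj; rewrite Dij Dij'.
  by have := lD i' _ lt_j; case: (D i' j) (e i' j) => //; [left | right].
have := v _ _ j' eqi; have := h i _ _ eqj; rewrite Dij Dij'.
by have := lD i _ lt_j'; case: (D i j') (e i j') => //; [left | right].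
Qed.

(** The four unit segments inside the two-by-two block, each seen from both adjacent cells; a droop
    toggles the use of exactly these. *)
Let inner (a b : 'I_n) (s : side) : bool :=
  match s with
  | South => (a == i) && ((b == j) || (b == j'))
  | North => (a == i') && ((b == j) || (b == j'))
  | East => (b == j) && ((a == i) || (a == i'))
  | West => (b == j') && ((a == i) || (a == i'))
  end.

Lemma droop_touch a b s : touch (D' a b) s = touch (D a b) s (+) inner a b s.
Proof.
have [c1 c2] := droop_corners; rewrite /D' mxE !xpair_eqE /inner.
have [->|na] := eqVneq a i; rewrite ?(eq_sym i) ?ne_i.
  have [->|nb] := eqVneq b j; rewrite ?(eq_sym j) ?ne_j /=.
    by rewrite Dij; case: s.
  have [->|nb'] := eqVneq b j' => /=; last by case: s; rewrite ?andbF ?addbF.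
  by case: c2 => ->; case: s.
have [->|na'] := eqVneq a i' => /=; last by case: s; rewrite ?andbF ?addbF.
have [->|nb] := eqVneq b j; rewrite ?(eq_sym j) ?ne_j /=.
  by case: c1 => ->; case: s.
have [->|nb'] := eqVneq b j' => /=; last by case: s; rewrite ?andbF ?addbF.
by rewrite Dij'; case: s.
Qed.

Lemma droop_not t a b : (t = Cross \/ t = Elbow) -> D a b <> t -> D' a b <> t.
Proof.
have [c1 c2] := droop_corners; move=> ct; rewrite /D' mxE !xpair_eqE.
case: ifP => _; first by case: ct => ->.
case: ifP => _; first by case: ct => ->.
case: ifP => _; first by case: c1 => -> _; case: ct => ->.
by case: ifP => _ //; case: c2 => -> _; case: ct => ->.
Qed.

Lemma droop_sorted : bpd_sorted D'.
Proof.
have [tD lD rD] := sD; have [e v h [bN bW bS bE]] := bpd_tilingP _ tD.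
have eq_ord (x y : 'I_n) : (x == y) = (x == y :> nat) by [].
split=> [|a b lt_b|a b le_kb].
- apply/bpd_tilingP; split=> [a b|a a' b eqa|a b b' eqb|].
  + by apply: droop_not; [right | apply: e].
  + rewrite !droop_touch (v _ _ _ eqa) /inner !eq_ord eqa eqi eqSS; by [].
  + rewrite !droop_touch (h _ _ _ eqb) /inner !eq_ord eqb eqj eqSS; by [].
  split=> a b eq0; rewrite droop_touch /inner !eq_ord.
  + by rewrite bN // eq0 eqi.
  + by rewrite bW // eq0 eqj.
  + rewrite bS //; have lti' := ltn_ord i'; have -> : a == i :> nat = false by lia.
    by [].
  + rewrite bE //; have ltj' := ltn_ord j'; have -> : b == j :> nat = false by lia.
    by [].
- by apply: droop_not; [left | apply: lD].
have nj : b == j = false by rewrite eq_ord; lia.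
have nj' : b == j' = false by rewrite eq_ord; lia.
by rewrite -rD // /D' mxE !xpair_eqE nj nj' !andbF.
Qed.

Lemma droop_blank a b : (D' a b == Blank) =
  if (a, b) == (i', j') then false
  else if (a, b) == (i, j) then true else D a b == Blank.
Proof.
have [c1 c2] := droop_corners; rewrite /D' mxE !xpair_eqE.
have [->|na] := eqVneq a i; rewrite ?(eq_sym i) ?ne_i /=.
  have [eb|nb] := eqVneq b j => //=.
  have [->|nb'] := eqVneq b j' => //=.
  by case: c2 => ->.
have [->|na'] := eqVneq a i' => //=.
have [->|nb] := eqVneq b j; rewrite ?(eq_sym j) ?ne_j /=.
  by case: c1 => ->.
by have [eb|nb'] := eqVneq b j'.
Qed.

Lemma pd_of_droop : pd_of D' = slide_at (pd_of D) i i' (mirror j') (mirror j).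
Proof.
have eq_mirror c x : (c == mirror x) = (mirror c == x).
  by rewrite -(inj_eq (can_inj mirrorK) c) mirrorK.
apply/matrixP => a c; rewrite [LHS]mxE droop_blank [RHS]mxE [pd_of D a c]mxE.
by rewrite !xpair_eqE !eq_mirror; do ![case: ifP => //].
Qed.

Lemma droop_slide : simple_slide (pd_of D) (pd_of D').
Proof.
have [c1 c2] := droop_corners.
apply/existsP; exists i; apply/existsP; exists i'.
apply/existsP; exists (mirror j'); apply/existsP; exists (mirror j).
rewrite pd_of_cross !pd_of_elbow !mirrorK Dij Dij' eqi pd_of_droop !eqxx /=.
have -> : mirror j == (mirror j').+1 :> nat.
  by rewrite !val_mirror //; do ![case: ifP]; lia.
by case: c1 => ->; case: c2 => ->.
Qed.

End Droop.

Lemma simple_droop_step D E : bpd_sorted D -> simple_droop D E ->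
  bpd_sorted E /\ simple_slide (pd_of D) (pd_of E).
Proof.
move=> sD /existsP[i /existsP[i' /existsP[j /existsP[j']]]].
case/and5P=> /eqP eqi /eqP eqj /eqP Dij /eqP Dij' /eqP ->.
by split; [apply: droop_sorted | apply: droop_slide].
Qed.

Lemma simple_slide_step D E : bpd_sorted D -> simple_slide (pd_of D) E ->
  exists2 D', simple_droop D D' & E = pd_of D'.
Proof.
move=> sD /existsP[i /existsP[i' /existsP[c /existsP[c']]]].
case/and5P=> /eqP eqi /eqP eqc; rewrite pd_of_cross !pd_of_elbow => /eqP Dic nb1.
case/and3P=> nb2 nb3 /eqP ->.
have [tD lD _] := sD; have [e v h [bN bW bS bE]] := bpd_tilingP _ tD.
have lt_c : mirror c < k by apply: (blank_left sD Dic).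
have lt_c0 : c < k by rewrite -mirror_lt.
(* A cross in column [k - 1] mirrors to a blank in column 0. The tile above it is neither blank nor
   a cross, yet would touch neither its south nor its west side. *)
have [lt_c'|le_c'] := ltnP c' k; last first.
  exfalso; have m0 : mirror c = 0 :> nat by rewrite val_mirror // lt_c0; lia.
  have := bW i _ m0; have := v _ _ (mirror c) eqi; rewrite Dic.
  have := lD i _ lt_c.
  by case: (D i (mirror c)) (e i (mirror c)) nb2.
have eqm : mirror c = (mirror c').+1 :> nat.
  by rewrite !val_mirror // lt_c' lt_c0; lia.
have lt_m : mirror c' < k by rewrite mirror_lt.
(* The non-blank tile above the blank must touch west, and the one to the left of the blank must
   touch north; so the remaining tile touches east and south, and it is not a cross. *)
have Dij : D i (mirror c') = RTile.
  have := v _ _ (mirror c) eqi; have := v _ _ (mirror c') eqi.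
  have := h i _ _ eqm; have := h i' _ _ eqm; rewrite Dic.
  have := lD i _ lt_c; have := lD i _ lt_m; have := lD i' _ lt_m.
  case: (D i' (mirror c')) (e i' (mirror c')) nb1 => //;
  case: (D i (mirror c)) (e i (mirror c)) nb2 => //;
  by case: (D i (mirror c')) (e i (mirror c')) nb3.
exists (droop_at D i i' (mirror c') (mirror c)).
  apply/existsP; exists i; apply/existsP; exists i'.
  apply/existsP; exists (mirror c'); apply/existsP; exists (mirror c).
  by rewrite eqi eqm Dij Dic !eqxx.
by rewrite (pd_of_droop sD eqi eqm Dij Dic) !mirrorK.
Qed.

Lemma connect_droop D E : bpd_sorted D -> connect (@simple_droop n) D E ->
  bpd_sorted E /\ connect (@simple_slide n) (pd_of D) (pd_of E).
Proof.
move=> sD /connectP[p]; elim: p D sD => [|D' p IH] D sD /=.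
  by move=> _ ->; rewrite connect0.
case/andP=> /(simple_droop_step sD)[sD' sl] pp eqE.
have [sE con] := IH _ sD' pp eqE; split=> //.
exact: connect_trans (connect1 sl) con.
Qed.

Lemma connect_slide D E : bpd_sorted D -> connect (@simple_slide n) (pd_of D) E ->
  exists2 D', connect (@simple_droop n) D D' & E = pd_of D'.
Proof.
move=> sD /connectP[p]; elim: p D sD => [|E' p IH] D sD /=.
  by move=> _ ->; exists D.
case/andP=> /(simple_slide_step sD)[D' dr ->] pp eqE.
have [sD' _] := simple_droop_step sD dr.
have [D'' con eqE'] := IH _ sD' pp eqE; exists D'' => //.
exact: connect_trans (connect1 dr) con.
Qed.

Lemma connect_pd_of D E : bpd_sorted D -> bpd_sorted E ->
  connect (@simple_slide n) (pd_of D) (pd_of E) = connect (@simple_droop n) D E.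
Proof.
move=> sD sE; apply/idP/idP => [con|/(connect_droop sD)[] //].
have [D' con' eqD'] := connect_slide sD con.
have [sD' _] := connect_droop sD con'.
by rewrite (pd_of_inj sE sD' eqD').
Qed.

(** * The Rothe bumpless pipe dream and the bottom pipe dream *)

Lemma rothe_tile D i j : rothe pi D -> D i j =
  if pi i == j then RTile
  else if i < (pi^-1 j)%g then if pi i < j then Horizontal else Blank
  else if pi i < j then Cross else Vertical.
Proof.
case/and3P=> tD /forallP rD /forallP jD.
have [e v h [bN bW bS bE]] := bpd_tilingP _ tD.
have rD' a b : (if D a b is RTile then true else false) = (pi a == b).
  by rewrite [RHS]eq_sym -(eqP (forallP (rD a) b)); case: (D a b).
have jD' a b : D a b <> JTile by apply/eqP; apply: forallP (jD a) b.
(* Without j-tiles, going up a column from the south border, vertical edges are used exactly up to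
   the r-tile; horizontal edges behave likewise from the east border. *)
have tS : touch (D i j) South = ((pi^-1 j)%g <= i).
  have [m] := ubnP (n - i); elim: m i => // m IH a lt_m; have lta := ltn_ord a.
  case: (ltnP a.+1 n) => [lt_a|le_a]; last first.
    by rewrite bS; [have := ltn_ord (pi^-1 j)%g; lia | lia].
  have [a' def_a'] := ord_of_nat lt_a.
  have := IH a'; rewrite (v _ _ _ def_a') => IHa.
  have := rD' a' j; rewrite -pi_inv_eq -val_eqE /= def_a'.
  have {}IHa : touch (D a' j) South = ((pi^-1 j)%g <= a') by apply: IHa; lia.
  move: IHa (e a' j) (jD' a' j); rewrite def_a'.
  by case: (D a' j) => //=; lia.
have tE : touch (D i j) East = (pi i <= j).
  clear tS; have [m] := ubnP (n - j); elim: m j => // m IH b lt_m; have ltb := ltn_ord b.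
  case: (ltnP b.+1 n) => [lt_b|le_b]; last first.
    by rewrite bE; [have := ltn_ord (pi i); lia | lia].
  have [b' def_b'] := ord_of_nat lt_b.
  have := IH b'; rewrite (h _ _ _ def_b') => IHb.
  have := rD' i b'; rewrite -val_eqE /= def_b'.
  have {}IHb : touch (D i b') East = (pi i <= b') by apply: IHb; lia.
  move: IHb (e i b') (jD' i b'); rewrite def_b'.
  by case: (D i b') => //=; lia.
case: ifP => [eqij|neij]; first by have := rD' i j; rewrite eqij; case: (D i j).
have ne1 : (pi i == j :> nat) = false by [].
have ne2 : ((pi^-1 j)%g == i :> nat) = false.
  by move: neij; rewrite -pi_inv_eq.
have := rD' i j; rewrite neij; move: tS tE (e i j) (jD' i j).
case: (D i j) => //= tS tE _ _ _; do ![case: ifP] => //; lia.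
Qed.

(** A cross in the first [k] columns would be an inversion in the lower range, and a blank beyond
    them an inversion in the upper one. *)
Lemma rothe_sorted D : rothe pi D -> bpd_sorted D.
Proof.
move=> rD; have [tD _ _] := and3P rD.
split=> // i j hj; rewrite rothe_tile //.
  case: ifP => // neij; case: ifP => [_|ge_i]; first by case: ifP.
  case: ifP => // lt_ij.
  have : (pi^-1 (pi i))%g < (pi^-1 j)%g by apply: inv_mono => //; lia.
  by rewrite permK; lia.
rewrite /frozen; case: ifP => // neij; case: ifP => // lt_i; case: ifP => // ge_ij.
have ne_ij : (pi i == j :> nat) = false by [].
have : (pi^-1 j)%g < (pi^-1 (pi i))%g by apply: inv_mono; lia.
by rewrite permK; lia.
Qed.

Lemma rothe_bottom D : rothe pi D -> bottom pi (pd_of D).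
Proof.
move=> rD; have sD := rothe_sorted rD; apply/andP; split.
  exact: (pd_sorted_PDred (pd_of_sorted sD)).
apply/forallP => i; apply/forallP => c; apply/forallP => c'; apply/implyP => /andP[lt_c].
rewrite !pd_of_cross => /eqP Dic; apply/eqP; move: (Dic).
have lt_m : mirror c < k by apply: (blank_left sD Dic).
have lt_ck : c < k by rewrite -mirror_lt.
have lt_mm : mirror c < mirror c' < k by rewrite !val_mirror //; do ![case: ifP]; lia.
rewrite !rothe_tile //; case: ifP => // ne1.
case: ifP => // lt_i; case: ifP => // ge_i _.
have lt_inv : (pi^-1 (mirror c))%g < (pi^-1 (mirror c'))%g by apply: inv_mono; lia.
have ne1' : (pi i == mirror c :> nat) = false by [].
(* A value [pi i] below [k] would form an inversion with the column of the blank. Hence every later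
   column up to [k] is also left of the r-tile of row [i], and its own r-tile lies further down. *)
have le_ki : k <= pi i.
  rewrite leqNgt; apply/negP => lt_pik.
  have : (pi^-1 (mirror c))%g < (pi^-1 (pi i))%g by apply: inv_mono; lia.
  by rewrite permK; lia.
case: eqP => [eq_pi|_]; first by move: le_ki; rewrite eq_pi; lia.
have -> : i < (pi^-1 (mirror c'))%g by lia.
by have -> : pi i < mirror c' = false by lia.
Qed.

Lemma bottom_rothe D : bpd_sorted D -> bottom pi (pd_of D) -> rothe pi D.
Proof.
move=> sD /andP[_ bD]; have [tD lD rD] := sD.
have [e v h [bN bW bS bE]] := bpd_tilingP _ tD.
have right_just (i b b' : 'I_n) : D i b = Blank -> b < b' < k -> D i b' = Blank.
  move=> Dib /andP[lt_b lt_b'].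
  have := forallP (forallP (forallP bD i) (mirror b)) (mirror b').
  rewrite !pd_of_cross !mirrorK Dib eqxx andbT => /implyP lj; apply/eqP/lj.
  by rewrite !val_mirror //; do ![case: ifP]; lia.
(* At a topmost j-tile, the tile above is vertical or an r-tile and the tile to the left is
   horizontal or an r-tile. The diagonal neighbour is then blank, and right-justification of blanks
   would make the tile above blank too. *)
have noJ i j : D i j <> JTile.
  have [m] := ubnP (nat_of_ord i); elim: m i j => // m IH i j lt_m DijJ.
  have lt_jk : j < k.
    rewrite ltnNge; apply/negP => le_kj; move: DijJ; rewrite rD // /frozen.
    by do ![case: ifP].
  have i_gt0 : 0 < i by rewrite lt0n; apply/eqP => i0; have := bN i j i0; rewrite DijJ.
  have j_gt0 : 0 < j by rewrite lt0n; apply/eqP => j0; have := bW i j j0; rewrite DijJ.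
  have lti := ltn_ord i; have ltj := ltn_ord j.
  have [i0 def_i0] : exists i0 : 'I_n, i0 = i.-1 :> nat by apply: ord_of_nat; lia.
  have [j0 def_j0] : exists j0 : 'I_n, j0 = j.-1 :> nat by apply: ord_of_nat; lia.
  have eqi : i = i0.+1 :> nat by lia.
  have eqj : j = j0.+1 :> nat by lia.
  have lt_j0 : j0 < k by lia.
  have noJ0 : D i0 j0 <> JTile by apply: IH; lia.
  have noJ1 : D i0 j <> JTile by apply: IH; lia.
  have rj : D i0 j0 = Blank -> D i0 j = Blank by move=> B; apply: right_just B _; lia.
  have := v _ _ j eqi; have := v _ _ j0 eqi; have := h i _ _ eqj; have := h i0 _ _ eqj.
  rewrite DijJ; move: (lD i0 _ lt_jk) (lD i0 _ lt_j0) (lD i _ lt_j0) noJ0 noJ1 rj.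
  case: (D i0 j) (e i0 j) => //; case: (D i j0) (e i j0) => //;
  by case: (D i0 j0) (e i0 j0) => // _ _ _ _ _ _ _ _ /(_ erefl).
have BD : D \in BPD pi by apply: bpd_sorted_BPD sD.
have pD : has_perm (@bpd_start n) (@bpd_exit n) D pi by move: BD; rewrite inE => /and3P[].
(* Without j-tiles, a used vertical edge continues straight down to the south border and a used
   horizontal one straight to the east border; comparing the two labels at an r-tile locates it. *)
have labS (i j : 'I_n) : touch (D i j) South ->
    seg_lab D (side_of i j South) = n + (pi^-1 j)%g.
  have [m] := ubnP (n - i); elim: m i => // m IH i lt_m tS; have lti := ltn_ord i.
  case: (ltnP i.+1 n) => [lt_i|le_i]; last first.
    have i_n : i.+1 = n by lia.
    by rewrite -(bpd_start_side _ i_n) (bpd_start_lab _ pD).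
  have [i' def_i'] := ord_of_nat lt_i.
  rewrite (side_of_SN _ def_i'); move: tS; rewrite (v _ _ _ def_i') => tN.
  have [st tS] : straight (D i' j) /\ touch (D i' j) South.
    by case: (D i' j) (e i' j) (noJ i' j) tN.
  by have [_ <-] := seg_lab_straight st; apply: IH => //; lia.
have labE (i j : 'I_n) : touch (D i j) East -> seg_lab D (side_of i j East) = n + i.
  have [m] := ubnP (n - j); elim: m j => // m IH j lt_m tE; have ltj := ltn_ord j.
  case: (ltnP j.+1 n) => [lt_j|le_j]; last by rewrite seg_lab_right //; lia.
  have [j' def_j'] := ord_of_nat lt_j.
  rewrite (side_of_EW _ def_j'); move: tE; rewrite (h _ _ _ def_j') => tW.
  have [st tE] : straight (D i j') /\ touch (D i j') East.
    by case: (D i j') (e i j') (noJ i j') tW.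
  by have [-> _] := seg_lab_straight st; apply: IH => //; lia.
have RP i j : D i j = RTile -> j = pi i.
  move=> Dij; have := labS i j; have := labE i j; rewrite Dij => /(_ isT) lE /(_ isT) lS.
  have [_ eqSE] : _ /\ _ := @seg_lab_turn n D i j (introN idP (fun st =>
     notF (etrans (congr1 (fun t => straight t) (esym Dij)) st))).
  move: eqSE; rewrite lE lS => /addnI/val_inj <-; by rewrite permKV.
(* In a column without r-tiles the pipe from the south border would climb to the north border. *)
have RE j : exists i, D i j = RTile.
  have [/existsP[i /eqP Dij]|/existsPn noR] := boolP [exists i, D i j == RTile].
    by exists i.
  have tN : forall i : 'I_n, touch (D i j) North.
    move=> i; have [m] := ubnP (n - i); elim: m i => // m IH i lt_m.
    have lti := ltn_ord i.
    have : touch (D i j) South.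
      case: (ltnP i.+1 n) => [lt_i|le_i]; last by apply: bS; lia.
      have [i' def_i'] := ord_of_nat lt_i.
      by rewrite (v _ _ _ def_i'); apply: IH; lia.
    by case: (D i j) (noR i).
  have ltj := ltn_ord j.
  have [i i0] : exists i : 'I_n, i = 0 :> nat by apply: ord_of_nat; lia.
  by have := tN i; rewrite bN.
apply/and3P; split=> //; last first.
  by apply/forallP => i; apply/forallP => j; apply/eqP/noJ.
apply/forallP => i; apply/forallP => j; apply/eqP.
apply/eqP/eqP => [/RP //|->].
have [i' Di'] := RE (pi i).
by have /perm_inj eq_i := RP _ _ Di'; rewrite -eq_i in Di'.
Qed.

(** The starting elements correspond under [pd_of], and paths of droops and of slides lift to each
    other. *)
Lemma droop_pd_of D : bpd_sorted D -> (D \in droop pi) = (pd_of D \in slide pi).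
Proof.
move=> sD; rewrite !inE; apply/existsP/existsP => -[B /andP[hB con]].
  exists (pd_of B); rewrite rothe_bottom //=.
  by have [] := connect_droop (rothe_sorted hB) con.
have sB : pd_sorted B by apply: PDred_sorted; case/andP: hB.
have sB' := bpd_of_sorted sB.
have eqB := bpd_ofK sB.
exists (bpd_of B); rewrite bottom_rothe ?eqB //=.
by rewrite -connect_pd_of // eqB.
Qed.

End TwoColours.

(** * Splitting the values of an inverse-Grassmannian permutation, and the resulting bijection *)

Lemma inverse_grassmannian_split n (pi : 'S_n) : inverse_grassmannian pi ->
  exists2 k, k <= n & forall a b : 'I_n, a < b -> (a < k) = (b < k) ->
    (pi^-1 a)%g < (pi^-1 b)%g.
Proof.
move=> /card_le1_eqP le1; set s := (pi^-1)%g in le1 *.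
have [k le_kn descP] : exists2 k, k <= n & forall i j : 'I_n,
    j = i.+1 :> nat -> j <> k :> nat -> s i < s j.
  have desc (i j : 'I_n) : j = i.+1 :> nat -> i \notin descents s -> s i < s j.
    move=> eqj; rewrite inE negb_exists => /forallP/(_ j).
    rewrite eqj eqxx /= -leqNgt leq_eqVlt => /predU1P[/val_inj/perm_inj eqij|//].
    by move: eqj; rewrite eqij; lia.
  have [des0 | [d desc_d]] := set_0Vmem (descents s).
    (* Without a descent one range suffices, so [k] is 0; otherwise [k] is one more than the only
       descent [d], which becomes the last value of the lower range. *)
    by exists 0 => // i j eqj _; apply: desc; rewrite // des0 inE.
  exists d.+1 => // i j eqj ne_j; apply: desc => //; apply/negP => desc_i.
  by apply: ne_j; rewrite eqj (le1 _ _ desc_i desc_d).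
exists k => // a b; have [m] := ubnP (b - a); elim: m b => // m IH b lt_m lt_ab eqk.
have ltb := ltn_ord b.
have [b' def_b'] : exists b' : 'I_n, b' = b.-1 :> nat by apply: ord_of_nat; lia.
have lt_b : s b' < s b by apply: descP; lia.
have [lt_ab'|le_b'a] := ltnP a b'.
  by apply: ltn_trans lt_b; apply: IH; lia.
by have <- : b' = a by apply: val_inj => /=; lia.
Qed.

Theorem theorem5p9 (n : nat) (pi : 'S_n) (hpi : inverse_grassmannian pi) :
  exists f : {D : 'M[tile]_n | D \in BPD pi} -> {D : 'M[tile]_n | D \in PDred pi},
    [/\ bijective f,
        forall D, pd_wt (sval (f D)) = bpd_wt (sval D),
        forall D, (sval D \in droop pi) = (sval (f D) \in slide pi)
      & forall D E, droop_le pi (sval D) (sval E)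
                    = slide_le pi (sval (f D)) (sval (f E))].
Proof.
have [k le_kn inv_mono] := inverse_grassmannian_split hpi.
have sB D : D \in BPD pi -> bpd_sorted k pi D := @BPD_sorted _ _ _ inv_mono D.
have sP E : E \in PDred pi -> pd_sorted k pi E := @PDred_sorted _ _ _ inv_mono E.
have fP (D : {D : 'M[tile]_n | D \in BPD pi}) : pd_of k (sval D) \in PDred pi.
  exact/(pd_sorted_PDred inv_mono)/(pd_of_sorted inv_mono le_kn)/sB/(svalP D).
have gP (E : {E : 'M[tile]_n | E \in PDred pi}) : bpd_of k pi (sval E) \in BPD pi.
  exact/(bpd_sorted_BPD inv_mono)/(bpd_of_sorted inv_mono le_kn)/sP/(svalP E).
pose f D := exist (fun E => E \in PDred pi) _ (fP D).
pose g E := exist (fun D => D \in BPD pi) _ (gP E).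
have gK : cancel g f by move=> E; apply: val_inj; exact: (bpd_ofK le_kn (sP _ (svalP E))).
have f_inj : injective f.
  move=> D1 D2 /(congr1 sval) /= eqE; apply: val_inj.
  exact: (pd_of_inj le_kn (sB _ (svalP D1)) (sB _ (svalP D2)) eqE).
exists f; split=> [|D|D|D E].
- by exists g => // D; apply: f_inj; rewrite gK.
- exact: pd_of_wt.
- exact: (droop_pd_of inv_mono le_kn (sB _ (svalP D))).
have [sD sE] := (sB _ (svalP D), sB _ (svalP E)).
rewrite /droop_le -(connect_pd_of le_kn sD sE).
by rewrite (droop_pd_of inv_mono le_kn sD) (droop_pd_of inv_mono le_kn sE).
Qed.
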